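(* Let $\alpha,\beta$ be determinate ordinals. Then (1) $\alpha+\beta$ is determinate; and (2) for every $n\in\mathbb{N}$, $\mbox{game-type}_n(\alpha+\beta)$ is computable from $\mbox{game-type}_n(\alpha)$ and $\mbox{game-type}_n(\beta)$ (there is an algorithm which, given $n$, $\mbox{game-type}_n(\alpha)$ and $\mbox{game-type}_n(\beta)$, outputs $\mbox{game-type}_n(\alpha+\beta)$).
   Context: MLO is monadic second-order logic over the signature $\{<\}$. For an ordinal $\gamma>0$ and an MLO formula $\varphi(X_1,X_2)$, the McNaughton game $\mathcal{G}^\gamma_\varphi$ has $\gamma$ rounds: at round $\delta<\gamma$ Player I first chooses $\pi_1(\delta)\in\{0,1\}$ and then Player II chooses $\pi_2(\delta)\in\{0,1\}$; with $P=\pi_1^{-1}(1)$, $Q=\pi_2^{-1}(1)$, Player I wins iff $(\gamma,<)\models\varphi(P,Q)$. A strategy of Player I is a strongly causal map $f:\mathcal{P}(\gamma)\to\mathcal{P}(\gamma)$ ($Q\cap[0,\delta)=Q'\cap[0,\delta)$ implies $f(Q)\cap[0,\delta]=f(Q')\cap[0,\delta]$), winning iff $(\gamma,<)\models\varphi(f(Q),Q)$ for all $Q$; a strategy of Player II is a causal map (hypothesis $P\cap[0,\delta]=P'\cap[0,\delta]$), winning iff $(\gamma,<)\models\neg\varphi(P,f(P))$ for all $P$. An ordinal $\gamma$ is determinate if for every MLO formula $\varphi(X_1,X_2)$ one of the players has a winning strategy in $\mathcal{G}^\gamma_\varphi$. $\mathit{Char}^n_2$ is a fixed finite computable set of MLO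 formulas of quantifier depth $\le n$ with free variables among $X_1,X_2$ such that each class of 2-chains agreeing on all MLO formulas of depth $\le n$ in $X_1,X_2$ is exactly the class of models of a unique member of $\mathit{Char}^n_2$. For $G\subseteq\mathit{Char}^n_2$, $\mathcal{G}^\gamma_G$ denotes $\mathcal{G}^\gamma_\varphi$ with $\varphi$ the disjunction of the formulas of $G$, and $\mbox{game-type}_n(\gamma)=\{G\subseteq\mathit{Char}^n_2\mid \text{Player I has a winning strategy in }\mathcal{G}^\gamma_G\}$. *)

(* Defs.v *)
From HB Require Import structures.
From Stdlib Require Import Relation_Operators Disjoint_Union Cantor.
From mathcomp Require Import all_boot finmap.
From mathcomp Require Import boolp classical_sets.

Set Implicit Arguments.
Unset Strict Implicit.
Unset Printing Implicit Defensive.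

Local Open Scope classical_set_scope.

(* [mlo m k]: formulas whose free variables are among the individual variables
   t_0, ..., t_{m-1} and the set variables X_0, ..., X_{k-1}.  [FEx1] binds t_m
   in a formula over t_0, ..., t_m, and [FEx2] binds X_k in a formula over
   X_0, ..., X_k.  Universal quantifiers and the other connectives are
   definable with the same quantifier depth.  [FFalse] is the empty disjunction;
   without it there would be no formula of depth 0 when m = 0. *)
Inductive mlo (m k : nat) : Type :=
  | FFalse
  | FLt of 'I_m & 'I_m
  | FEq of 'I_m & 'I_m
  | FIn of 'I_m & 'I_k
  | FNot of mlo m k
  | FAnd of mlo m k & mlo m k
  | FOr of mlo m k & mlo m k
  | FEx1 of mlo m.+1 k
  | FEx2 of mlo m k.+1.

Arguments FFalse {m k}.
Arguments FLt {m k}.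
Arguments FEq {m k}.
Arguments FIn {m k}.

Fixpoint qd m k (phi : mlo m k) : nat :=
  match phi with
  | FFalse | FLt _ _ | FEq _ _ | FIn _ _ => 0
  | FNot p => qd p
  | FAnd p q | FOr p q => maxn (qd p) (qd q)
  | FEx1 p => (qd p).+1
  | FEx2 p => (qd p).+1
  end.

Record chain : Type := Chain {
  point :> Type;
  clt : point -> point -> Prop;
  clt_irr : forall x, ~ clt x x;
  clt_trans : forall x y z, clt x y -> clt y z -> clt x z;
  clt_total : forall x y, clt x y \/ x = y \/ clt y x }.

(* [x] becomes the value of the variable with the new, largest index. *)
Definition ext n (T : Type) (e : 'I_n -> T) (x : T) : 'I_n.+1 -> T :=
  fun i => oapp e x (unlift ord_max i).

Fixpoint sat (M : chain) m k (phi : mlo m k) (e : 'I_m -> M) (v : 'I_k -> set M)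
    {struct phi} : Prop :=
  match phi with
  | FFalse => False
  | FLt i j => clt (e i) (e j)
  | FEq i j => e i = e j
  | FIn i j => v j (e i)
  | FNot p => ~ sat p e v
  | FAnd p q => sat p e v /\ sat q e v
  | FOr p q => sat p e v \/ sat q e v
  | FEx1 p => exists x : M, sat p (ext e x) v
  | FEx2 p => exists X : set M, sat p e (ext v X)
  end.

Fixpoint signed_conjs m k (s : seq (mlo m k)) : seq (mlo m k) :=
  if s is b :: s' then
    [seq FAnd b r | r <- signed_conjs s'] ++
    [seq FAnd (FNot b) r | r <- signed_conjs s']
  else [:: FNot FFalse].

Definition atoms m k : seq (mlo m k) :=
  [seq FLt i j | i <- enum 'I_m, j <- enum 'I_m] ++
  [seq FEq i j | i <- enum 'I_m, j <- enum 'I_m] ++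
  [seq FIn i j | i <- enum 'I_m, j <- enum 'I_k].

(* Hintikka formulas, with Char^n_2 := [Char n 0 2].  [Char_qd] and [Char_class]
   below are the properties that characterize them.  Some members have no
   model. *)
Fixpoint Char (n m k : nat) : seq (mlo m k) :=
  if n is n'.+1 then
    signed_conjs ([seq FEx1 t | t <- Char n' m.+1 k] ++
                  [seq FEx2 t | t <- Char n' m k.+1])
  else signed_conjs (atoms m k).

(* An ordinal is presented by a well-ordered type; every notion below is
   invariant under isomorphism. *)
Record wellorder : Type := WellOrder {
  ochain :> chain;
  clt_wf : well_founded (@clt ochain) }.

Section OrdinalSum.
Variables a b : wellorder.

Let lt_sum : a + b -> a + b -> Prop := le_AsB a b (@clt a) (@clt b).

Fact lt_sum_irr x : ~ lt_sum x x.
Proof. by case: x => x h; inversion h; apply: (clt_irr (x := x)). Qed.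

Fact lt_sum_trans x y z : lt_sum x y -> lt_sum y z -> lt_sum x z.
Proof.
move=> [{}x {}y xy|{}x {}y|{}x {}y xy] h; inversion h; subst; constructor;
  exact: clt_trans xy _.
Qed.

Fact lt_sum_total x y : lt_sum x y \/ x = y \/ lt_sum y x.
Proof.
case: x y => x [] y.
- case: (clt_total x y) => [h|[->|h]]; first by left; constructor.
  + by right; left.
  + by right; right; constructor.
- by left; constructor.
- by right; right; constructor.
- case: (clt_total x y) => [h|[->|h]]; first by left; constructor.
  + by right; left.
  + by right; right; constructor.
Qed.

Definition oadd : wellorder :=
  @WellOrder (Chain lt_sum_irr lt_sum_trans lt_sum_total)
    (wf_disjoint_sum _ _ _ _ (@clt_wf a) (@clt_wf b)).

End OrdinalSum.

Section Games.
Variable g : wellorder.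

Definition below (d : g) : set g := [set x | clt x d].
Definition upto (d : g) : set g := [set x | clt x d \/ x = d].

(* A play of g rounds is a pair of subsets of g, the rounds at which each player
   chose 1; Player I moves first in each round, hence [below] in the hypothesis
   here and [upto] in that of [causal]. *)
Definition strongly_causal (f : set g -> set g) : Prop :=
  forall (d : g) (Q Q' : set g),
    Q `&` below d = Q' `&` below d -> f Q `&` upto d = f Q' `&` upto d.

Definition causal (f : set g -> set g) : Prop :=
  forall (d : g) (P P' : set g),
    P `&` upto d = P' `&` upto d -> f P `&` upto d = f P' `&` upto d.

Definition no_points (i : 'I_0) : g := False_rect g (notF (ltn_ord i)).

Definition holds (phi : mlo 0 2) (P Q : set g) : Prop :=
  sat phi no_points (fun i : 'I_2 => if i == ord0 then P else Q).

Definition wins_I (phi : mlo 0 2) : Prop :=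
  exists2 f, strongly_causal f & forall Q, holds phi (f Q) Q.

Definition wins_II (phi : mlo 0 2) : Prop :=
  exists2 f, causal f & forall P, ~ holds phi P (f P).

Definition determinate : Prop := forall phi : mlo 0 2, wins_I phi \/ wins_II phi.

End Games.

Fixpoint code m k (phi : mlo m k) : nat :=
  match phi with
  | FFalse => to_nat (0, 0)
  | FLt i j => to_nat (1, to_nat (val i, val j))
  | FEq i j => to_nat (2, to_nat (val i, val j))
  | FIn i j => to_nat (3, to_nat (val i, val j))
  | FNot p => to_nat (4, code p)
  | FAnd p q => to_nat (5, to_nat (code p, code q))
  | FOr p q => to_nat (6, to_nat (code p, code q))
  | FEx1 p => to_nat (7, code p)
  | FEx2 p => to_nat (8, code p)
  end.

#[local] Arguments to_nat : simpl never.

Lemma code_inj m k : injective (@code m k).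
Proof.
elim=> {m k} [m k|m k i j|m k i j|m k i j|m k p IH|m k p IHp q IHq|m k p IHp q IHq
  |m k p IH|m k p IH] [|i' j'|i' j'|i' j'|p'|p' q'|p' q'|p'|p'] //= /to_nat_inj // [].
- by move=> /to_nat_inj [/val_inj -> /val_inj ->].
- by move=> /to_nat_inj [/val_inj -> /val_inj ->].
- by move=> /to_nat_inj [/val_inj -> /val_inj ->].
- by move=> /IH ->.
- by move=> /to_nat_inj [/IHp -> /IHq ->].
- by move=> /to_nat_inj [/IHp -> /IHq ->].
- by move=> /IH ->.
- by move=> /IH ->.
Qed.

HB.instance Definition _ m k := Equality.copy (mlo m k) (inj_type (@code_inj m k)).
HB.instance Definition _ m k := gen_choiceMixin (mlo m k).

Definition code_seq (s : seq nat) : nat :=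
  foldr (fun x c => (to_nat (x, c)).+1) 0 s.

Definition disj m k (G : {fset mlo m k}) : mlo m k := foldr (@FOr m k) FFalse G.

Definition game_type (n : nat) (g : wellorder) : set {fset mlo 0 2} :=
  [set G | {subset G <= Char n 0 2} /\ wins_I g (disj G)].

(* A finite set of finite sets of formulas is handed to an algorithm as (the
   code of) any list of lists that enumerates it. *)
Definition is_code (c : nat) (F : set {fset mlo 0 2}) : Prop :=
  exists2 s : seq (seq (mlo 0 2)),
    F = [set` [seq [fset phi in g]%fset | g <- s]] &
    c = code_seq [seq code_seq [seq code phi | phi <- g] | g <- s].

(* Kleene's partial recursive functions, with the arity as index. *)
Inductive recfn : nat -> Type :=
  | RZero k : recfn k
  | RSucc : recfn 1
  | RProj k : 'I_k -> recfn k
  | RComp j k : recfn j -> ('I_j -> recfn k) -> recfn k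
  | RPrec k : recfn k -> recfn k.+2 -> recfn k.+1
  | RMu k : recfn k.+1 -> recfn k.

Inductive eval : forall k, recfn k -> k.-tuple nat -> nat -> Prop :=
  | eval_zero k (v : k.-tuple nat) : eval (RZero k) v 0
  | eval_succ x : eval RSucc [tuple x] x.+1
  | eval_proj k (i : 'I_k) v : eval (RProj i) v (tnth v i)
  | eval_comp j k (f : recfn j) (h : 'I_j -> recfn k) v w y :
      (forall i, eval (h i) v (tnth w i)) -> eval f w y -> eval (RComp f h) v y
  | eval_prec0 k (f : recfn k) (h : recfn k.+2) (v : k.-tuple nat) y :
      eval f v y -> eval (RPrec f h) [tuple of 0 :: v] y
  | eval_precS k (f : recfn k) (h : recfn k.+2) (v : k.-tuple nat) (x z y : nat) :
      eval (RPrec f h) [tuple of x :: v] z ->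
      eval h [tuple of [:: x, z & v]] y ->
      eval (RPrec f h) [tuple of x.+1 :: v] y
  | eval_mu k (f : recfn k.+1) (v : k.-tuple nat) (x : nat) (w : nat -> nat) :
      (forall i, i < x -> eval f [tuple of i :: v] (w i).+1) ->
      eval f [tuple of x :: v] 0 ->
      eval (RMu f) v x.

Lemma signed_conjs_qd m k (s : seq (mlo m k)) n :
  all (fun b => qd b <= n) s -> all (fun t => qd t <= n) (signed_conjs s).
Proof.
elim: s => //= b s IH /andP[hb /IH hs].
by rewrite all_cat !all_map; apply/andP; split; apply: sub_all hs => t /=;
  rewrite geq_max hb.
Qed.

Lemma Char_qd n m k t : t \in Char n m k -> qd t <= n.
Proof.
suff /allP : all (fun t => qd t <= n) (Char n m k) by apply.
elim: n m k {t} => [|n IH] m k; apply: signed_conjs_qd.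
  by rewrite !all_cat; apply/and3P; split; apply/allP => b /allpairsP[? [_ _ ->]].
by rewrite all_cat !all_map; apply/andP; split; apply: sub_all (IH _ _).
Qed.

Section SignedConjs.
Variables m k : nat.
Implicit Type s : seq (mlo m k).

Lemma signed_conjs_ex (M : chain) s (e : 'I_m -> M) (v : 'I_k -> set M) :
  exists2 t, t \in signed_conjs s & sat t e v.
Proof.
elim: s => [|b s [t ts st]]; first by exists (FNot FFalse); rewrite ?inE //= => -[].
have [h|h] := EM (sat b e v).
- by exists (FAnd b t) => //=; rewrite mem_cat map_f.
- by exists (FAnd (FNot b) t) => //=; rewrite mem_cat orbC map_f.
Qed.

Lemma signed_conjs_uniq (M : chain) s (e : 'I_m -> M) (v : 'I_k -> set M) t t' :
  t \in signed_conjs s -> t' \in signed_conjs s ->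
  sat t e v -> sat t' e v -> t = t'.
Proof.
elim: s t t' => [|b s IH] t t' /=; first by rewrite !inE => /eqP -> /eqP ->.
rewrite !mem_cat => /orP[]/mapP[r rs ->] /orP[]/mapP[r' rs' ->] /= [h sr] [h' sr'];
  by [|rewrite (IH _ _ rs rs' sr sr')].
Qed.

Lemma signed_conjs_agree (M M' : chain) s (e : 'I_m -> M) (v : 'I_k -> set M)
    (e' : 'I_m -> M') (v' : 'I_k -> set M') t b :
  t \in signed_conjs s -> sat t e v -> sat t e' v' -> b \in s ->
  (sat b e v <-> sat b e' v').
Proof.
elim: s t => //= c s IH t.
rewrite mem_cat => /orP[]/mapP[r rs ->] /= [h sr] [h' sr'];
  rewrite inE => /predU1P[->|]; by [|exact: IH sr'].
Qed.

End SignedConjs.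

Lemma Char_ex n m k (M : chain) (e : 'I_m -> M) (v : 'I_k -> set M) :
  exists2 t, t \in Char n m k & sat t e v.
Proof. by case: n => [|n]; apply: signed_conjs_ex. Qed.

Lemma agree_closure N m k (phi : mlo m k) (M M' : chain)
    (e : 'I_m -> M) (v : 'I_k -> set M) (e' : 'I_m -> M') (v' : 'I_k -> set M') :
  (forall b, b \in atoms m k -> (sat b e v <-> sat b e' v')) ->
  (forall p, qd p < N -> (sat (FEx1 p) e v <-> sat (FEx1 p) e' v')) ->
  (forall p, qd p < N -> (sat (FEx2 p) e v <-> sat (FEx2 p) e' v')) ->
  qd phi <= N -> (sat phi e v <-> sat phi e' v').
Proof.
elim: phi M M' e v e' v' => {m k} [m k|m k i j|m k i j|m k i j|m k p IHp
  |m k p IHp q IHq|m k p IHp q IHq|m k p _|m k p _] M M' e v e' v' A S1 S2.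
- by [].
- by move=> _; apply: A; rewrite !mem_cat allpairs_f ?mem_enum.
- by move=> _; apply: A; rewrite !mem_cat [X in _ || (X || _)]allpairs_f ?mem_enum ?orbT.
- by move=> _; apply: A; rewrite !mem_cat [X in _ || (_ || X)]allpairs_f ?mem_enum ?orbT.
- by move=> /= h; move: (IHp _ _ _ _ _ _ A S1 S2 h); tauto.
- rewrite /= geq_max => /andP[hp hq].
  by move: (IHp _ _ _ _ _ _ A S1 S2 hp) (IHq _ _ _ _ _ _ A S1 S2 hq); tauto.
- rewrite /= geq_max => /andP[hp hq].
  by move: (IHp _ _ _ _ _ _ A S1 S2 hp) (IHq _ _ _ _ _ _ A S1 S2 hq); tauto.
- exact: S1.
- exact: S2.
Qed.

Lemma Char_agree n m k (M M' : chain) (e : 'I_m -> M) (v : 'I_k -> set M)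
    (e' : 'I_m -> M') (v' : 'I_k -> set M') t :
  t \in Char n m k -> sat t e v -> sat t e' v' ->
  forall phi : mlo m k, qd phi <= n -> (sat phi e v <-> sat phi e' v').
Proof.
elim: n m k M M' e v e' v' t => [|n IH] m k M M' e v e' v' t tC st st' phi.
  by apply: agree_closure => // b; apply: signed_conjs_agree st'.
have A b := @signed_conjs_agree _ _ _ _ _ e v e' v' t b tC st st'.
have A1 r : r \in Char n m.+1 k -> (sat (FEx1 r) e v <-> sat (FEx1 r) e' v').
  by move=> rC; apply: A; rewrite mem_cat map_f.
have A2 r : r \in Char n m k.+1 -> (sat (FEx2 r) e v <-> sat (FEx2 r) e' v').
  by move=> rC; apply: A; rewrite mem_cat orbC map_f.
apply: agree_closure => [|p hp|p hp].
- have [r rC hr] := Char_ex n e (ext v set0).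
  have [X hr'] := (A2 r rC).1 (ex_intro _ set0 hr).
  have B := IH _ _ _ _ _ _ _ _ _ rC hr hr'.
  move=> b; rewrite !mem_cat => /or3P[] /allpairsP[[i j] [_ _ ->]].
  + exact: (B (FLt i j)).
  + exact: (B (FEq i j)).
  + by have := B (FIn i (lift ord_max j)) isT; rewrite /= /ext liftK.
- split=> -[x hx].
  + have [r rC hr] := Char_ex n (ext e x) v.
    have [x' hr'] := (A1 r rC).1 (ex_intro _ x hr).
    by exists x'; apply/(IH _ _ _ _ _ _ _ _ _ rC hr hr' p hp).
  + have [r rC hr'] := Char_ex n (ext e' x) v'.
    have [x' hr] := (A1 r rC).2 (ex_intro _ x hr').
    by exists x'; apply/(IH _ _ _ _ _ _ _ _ _ rC hr hr' p hp).
- split=> -[x hx].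
  + have [r rC hr] := Char_ex n e (ext v x).
    have [x' hr'] := (A2 r rC).1 (ex_intro _ x hr).
    by exists x'; apply/(IH _ _ _ _ _ _ _ _ _ rC hr hr' p hp).
  + have [r rC hr'] := Char_ex n e' (ext v' x).
    have [x' hr] := (A2 r rC).2 (ex_intro _ x hr').
    by exists x'; apply/(IH _ _ _ _ _ _ _ _ _ rC hr hr' p hp).
Qed.

Theorem Char_class n m k (M : chain) (e : 'I_m -> M) (v : 'I_k -> set M) :
  exists! t : mlo m k, t \in Char n m k /\
    forall (M' : chain) (e' : 'I_m -> M') (v' : 'I_k -> set M'),
      sat t e' v' <->
      forall phi : mlo m k, qd phi <= n -> (sat phi e v <-> sat phi e' v').
Proof.
have [t tC st] := Char_ex n e v; exists t; split.
  split=> // M' e' v'; split=> [st'|h]; first exact: Char_agree tC st st'.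
  exact: (h t (Char_qd tC)).1.
move=> t' [tC' /(_ M e v) [_ st']]; have {}st' : sat t' e v by apply: st'.
by case: n tC tC' => [|n] tC tC'; apply: signed_conjs_uniq tC tC' st st'.
Qed.

(* Main.v *)
Require Import Defs.
From Stdlib Require Import Cantor.
From mathcomp Require Import all_boot finmap.
From mathcomp Require Import zify.
From mathcomp Require Import boolp classical_sets.

(* A play on a + b is a play on a followed by a play on b.  By the composition
   theorem the n-type of the whole play is determined by the n-types tau and sigma
   of the two parts.  So, for a goal set G, the play on a only decides which game
   {sigma | tau + sigma in G} is then played on b, and as that game is determinate,
   Player I wins on a + b iff he can force on a some tau for which he wins it on b.

   For computability, the type of a sum is found by evaluating rho on the codes of
   tau and sigma: quantified types are looked up among the conjuncts of tau and
   sigma.  On formulas without models this gives arbitrary answers, which are never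
   used.  The set of all n-types need not be generated, being the largest member of
   the given game type. *)

Set Implicit Arguments.
Unset Strict Implicit.
Unset Printing Implicit Defensive.

#[local] Arguments to_nat : simpl never.
#[local] Arguments of_nat : simpl never.

(** * Total recursive functions of encoded data *)

Definition cmp k (F : k.-tuple nat -> nat) : Prop :=
  exists c : recfn k, forall v, eval c v (F v).

Definition fun1 (f : nat -> nat) := cmp (fun v : 1.-tuple nat => f (tnth v (inord 0))).
Definition fun2 (f : nat -> nat -> nat) :=
  cmp (fun v : 2.-tuple nat => f (tnth v (inord 0)) (tnth v (inord 1))).
Definition fun3 (f : nat -> nat -> nat -> nat) :=
  cmp (fun v : 3.-tuple nat =>
    f (tnth v (inord 0)) (tnth v (inord 1)) (tnth v (inord 2))).

Lemma cmp_ext k (F G : k.-tuple nat -> nat) : F =1 G -> cmp F -> cmp G.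
Proof. by move=> FG [c cP]; exists c => v; rewrite -FG. Qed.

Lemma cmp_proj k i : cmp (fun v : k.-tuple nat => tnth v i).
Proof. by exists (RProj i) => v; constructor. Qed.

Lemma cmp_comp j k F (H : 'I_j -> k.-tuple nat -> nat) :
  cmp F -> (forall i, cmp (H i)) -> cmp (fun v => F [tuple H i v | i < j]).
Proof.
case=> c cP /boolp.choice[h hP]; exists (RComp c h) => v.
by apply: eval_comp (cP _) => i; rewrite tnth_mktuple.
Qed.

Lemma cmp_ap1 f k (F : k.-tuple nat -> nat) :
  fun1 f -> cmp F -> cmp (fun v => f (F v)).
Proof.
move=> cf cF; have := cmp_comp (H := fun=> F) cf (fun=> cF).
by apply: cmp_ext => v; rewrite tnth_mktuple.
Qed.

Lemma cmp_ap2 f k (F G : k.-tuple nat -> nat) :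
  fun2 f -> cmp F -> cmp G -> cmp (fun v => f (F v) (G v)).
Proof.
move=> cf cF cG; have := cmp_comp (H := fun i => if i == inord 0 then F else G) cf.
have cH (i : 'I_2) : cmp (if i == inord 0 then F else G) by case: ifP.
move=> /(_ cH); apply: cmp_ext => v; rewrite !tnth_mktuple eqxx.
by rewrite -(inj_eq val_inj) /= !inordK.
Qed.

(** One parameter is enough, since [to_nat] packs several into one number. [h] receives the counter,
    the previous value and the parameter. *)
Lemma fun2_prec g h : fun1 g -> fun3 h ->
  fun2 (fun n x => nat_rec (fun=> nat) (g x) (fun i z => h i z x) n).
Proof.
move=> [c cP] [d dP]; exists (RPrec c d) => v.
case/tupleP: v => n v; case/tupleP: v => x v; rewrite (tuple0 v) {v}.
have -> : tnth [tuple n; x] (inord 0) = n by rewrite (tnth_nth 0) inordK.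
have -> : tnth [tuple n; x] (inord 1) = x by rewrite (tnth_nth 0) inordK.
elim: n => [|n IH] /=.
  have := cP [tuple x]; rewrite (tnth_nth 0) inordK //=.
  exact: eval_prec0.
apply: eval_precS IH _ => /=.
by have := dP [tuple n; nat_rec (fun=> nat) (g x) (fun i z => h i z x) n; x];
  rewrite !(tnth_nth 0) !inordK //=; congr eval; apply: val_inj.
Qed.

Lemma fun1S : fun1 S.
Proof.
exists RSucc => v; case/tupleP: v => x v; rewrite (tuple0 v) (tnth_nth 0) inordK //.
exact: eval_succ.
Qed.

Lemma fun1_const c : fun1 (fun=> c).
Proof.
elim: c => [|c IH]; first by exists (RZero 1) => v; constructor.
exact: cmp_ap1 fun1S IH.
Qed.

Lemma fun2_swap f : fun2 f -> fun2 (fun x y => f y x).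
Proof. by move=> cf; apply: cmp_ap2 cf _ _; apply: cmp_proj. Qed.

Lemma fun2_add : fun2 addn.
Proof.
have : fun2 (fun n x => nat_rec (fun=> nat) x (fun i z => z.+1) n).
  by apply: fun2_prec; [exact: cmp_proj | apply: cmp_ap1 fun1S (cmp_proj _)].
by apply: cmp_ext => v; elim: (tnth v (inord 0)) => //= n ->.
Qed.

Lemma fun2_mul : fun2 muln.
Proof.
have : fun2 (fun n x => nat_rec (fun=> nat) 0 (fun i z => z + x) n).
  apply: (fun2_prec (fun1_const 0)).
  by apply: cmp_ap2 fun2_add _ _; apply: cmp_proj.
by apply: cmp_ext => v; elim: (tnth v (inord 0)) => //= n ->; lia.
Qed.

Lemma fun1_pred : fun1 predn.
Proof.
(* The recursion returns its counter, which is n - 1 at the last step. *)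
have : fun2 (fun n x => nat_rec (fun=> nat) 0 (fun i z => i) n).
  by apply: (fun2_prec (fun1_const 0)); apply: cmp_proj.
move=> c; have := cmp_ap2 c (cmp_proj (inord 0 : 'I_1)) (cmp_proj (inord 0)).
by apply: cmp_ext => v; case: (tnth v _).
Qed.

Lemma fun2_sub : fun2 subn.
Proof.
(* The recursion runs on the subtrahend, which therefore comes first; the arguments are swapped
   afterwards. *)
have : fun2 (fun n x => nat_rec (fun=> nat) x (fun i z => z.-1) n).
  by apply: fun2_prec; [exact: cmp_proj | apply: cmp_ap1 fun1_pred (cmp_proj _)].
move/fun2_swap; apply: cmp_ext => v.
by elim: (tnth v (inord 1)) => //= [|n ->]; lia.
Qed.

(** The triangular number 1 + ... + n, written as inside [to_nat], so that [to_natE] holds by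
    computation. *)
Definition tri n := nat_rec (fun=> nat) 0 (fun i z => i.+1 + z) n.

Lemma fun1_tri : fun1 tri.
Proof.
have : fun2 (fun n (x : nat) => nat_rec (fun=> nat) 0 (fun i z => i.+1 + z) n).
  apply: (fun2_prec (fun1_const 0)); apply: cmp_ap2 fun2_add _ _.
    exact: cmp_ap1 fun1S (cmp_proj _).
  exact: cmp_proj.
by move=> c; have := cmp_ap2 c (cmp_proj (inord 0 : 'I_1)) (cmp_proj (inord 0)).
Qed.

Lemma to_natE x y : to_nat (x, y) = y + tri (y + x).
Proof. by []. Qed.

Lemma fun2_pair : fun2 (fun x y => to_nat (x, y)).
Proof.
apply: cmp_ext (fun v => esym (to_natE _ _)) _.
apply: cmp_ap2 fun2_add _ (cmp_ap1 fun1_tri (cmp_ap2 fun2_add _ _)); exact: cmp_proj.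
Qed.

(** Subtraction is truncated, so the inner sum is the distance of x and y. *)
Definition eq_sub x y := 1 - (x - y + (y - x)).

Lemma eq_subE x y : eq_sub x y = (x == y) :> nat.
Proof. by rewrite /eq_sub; case: eqP => /=; lia. Qed.

Lemma fun2_eq : fun2 (fun x y => (x == y) : nat).
Proof.
apply: cmp_ext (fun v => eq_subE _ _) _; apply: cmp_ap2 fun2_sub _ _.
  exact: cmp_ap1 (fun1_const 1) (cmp_proj (inord 0)).
by apply: cmp_ap2 fun2_add _ _; apply: cmp_ap2 fun2_sub _ _; apply: cmp_proj.
Qed.

(** The value is b F + (1 - b) G, with [b] read as 0 or 1. *)
Lemma cmp_if k (b : k.-tuple nat -> bool) F G :
  cmp (fun v => b v : nat) -> cmp F -> cmp G -> cmp (fun v => if b v then F v else G v).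
Proof.
move=> cb cF cG; have cN := cmp_ap2 fun2_sub (cmp_ap1 (fun1_const 1) cb) cb.
have := cmp_ap2 fun2_add (cmp_ap2 fun2_mul cb cF) (cmp_ap2 fun2_mul cN cG).
by apply: cmp_ext => v; case: (b v); lia.
Qed.

(* The index x + y of the diagonal of (x, y) = of_nat n grows by one exactly after
   the last point (0, y) of a diagonal. *)
Definition diag n :=
  nat_rec (fun=> nat) 0 (fun i w => if i - tri w == w then w.+1 else w) n.

Lemma of_natS n : of_nat n.+1 =
  if (of_nat n).1 is x.+1 then (x, (of_nat n).2.+1) else ((of_nat n).2.+1, 0).
Proof. by rewrite {1}/of_nat /= -/(of_nat n); case: (of_nat n) => [[|x] y]. Qed.

Lemma diagE n : diag n = (of_nat n).2 + (of_nat n).1.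
Proof.
elim: n => // n IH; rewrite of_natS /= -/(diag n) IH.
(* With n written as [to_nat (x, y)] the test compares y with y + x, so it succeeds exactly when x =
   0. *)
have := cancel_to_of n; case: (of_nat n) => [x y] /=; rewrite to_natE => <-.
by rewrite addnK; case: x => [|x] /=; case: eqP; lia.
Qed.

Lemma fun1_diag : fun1 diag.
Proof.
have : fun2 (fun n (x : nat) => nat_rec (fun=> nat) 0
   (fun i w => if i - tri w == w then w.+1 else w) n).
  apply: (fun2_prec (fun1_const 0)).
  apply: cmp_if (cmp_ap2 fun2_eq (cmp_ap2 fun2_sub _ (cmp_ap1 fun1_tri _)) _) (cmp_ap1 fun1S _) _;
  exact: cmp_proj.
by move=> c; have := cmp_ap2 c (cmp_proj (inord 0 : 'I_1)) (cmp_proj (inord 0)).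
Qed.

(** [tri (diag n)] is the first code on the diagonal of n, and the second coordinate is the offset
    from it. *)
Lemma of_nat2 n : (of_nat n).2 = n - tri (diag n).
Proof.
by rewrite diagE -{2}[n]cancel_to_of; case: (of_nat n) => x y /=; rewrite to_natE; lia.
Qed.

Lemma of_nat1 n : (of_nat n).1 = diag n - (of_nat n).2.
Proof. by rewrite diagE addKn. Qed.

Lemma fun1_of_nat2 : fun1 (fun n => (of_nat n).2).
Proof.
apply: cmp_ext (fun v => esym (of_nat2 _)) _.
apply: cmp_ap2 fun2_sub _ (cmp_ap1 fun1_tri (cmp_ap1 fun1_diag _)); exact: cmp_proj.
Qed.

Lemma fun1_of_nat1 : fun1 (fun n => (of_nat n).1).
Proof.
apply: cmp_ext (fun v => esym (of_nat1 _)) _.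
apply: cmp_ap2 fun2_sub (cmp_ap1 fun1_diag _) (cmp_ap1 fun1_of_nat2 _); exact: cmp_proj.
Qed.

(** * Computable functions between encoded types *)

Class enc (A : Type) := Enc { encode : A -> nat; encode_inj : injective encode }.

Arguments encode_inj {A enc}.

Instance enc_nat : enc nat := Enc (@inj_id nat).

Lemma nat_of_bool_inj : injective nat_of_bool.
Proof. by case=> -[]. Qed.

Instance enc_bool : enc bool := Enc nat_of_bool_inj.

Section EncPairSeq.
Context (A B : Type) {eA : enc A} {eB : enc B}.

Lemma encode_pair_inj : injective (fun p : A * B => to_nat (encode p.1, encode p.2)).
Proof. by case=> a b [a' b'] /= /to_nat_inj[/(@encode_inj _ eA) -> /(@encode_inj _ eB) ->]. Qed.

Global Instance enc_prod : enc (A * B) := Enc encode_pair_inj.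

(** Lists are coded by [code_seq], so that lists of lists of formula codes get the codes that
    [is_code] prescribes. *)
Lemma encode_seq_inj : injective (fun s : seq A => code_seq (map encode s)).
Proof.
by elim=> [|a s IH] [|a' s'] //= [] /to_nat_inj[/(@encode_inj _ eA) -> /IH ->].
Qed.

Global Instance enc_seq : enc (seq A) := Enc encode_seq_inj.

End EncPairSeq.

(** A code bounds the data inside it, which is why codes can serve as fuel and as iteration
    counts. *)
Lemma leq_to_nat x y : y + x <= to_nat (x, y).
Proof. by rewrite to_natE; case: (y + x) => [|n] /=; lia. Qed.

Lemma size_encode A {eA : enc A} (s : seq A) : size s <= encode s.
Proof.
by elim: s => // a s /= IH; apply: leq_trans (leq_to_nat _ _); apply: leq_trans IH (leq_addr _ _).
Qed.

(** [g] is constrained on codes only; on other numbers it may take any value. *)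
Definition computable A B {eA : enc A} {eB : enc B} (f : A -> B) : Prop :=
  exists2 g, fun1 g & forall a, g (encode a) = encode (f a).

Section Comp.
Context (X A B : Type) {eX : enc X} {eA : enc A} {eB : enc B}.

Lemma comp_ext (f g : X -> A) : f =1 g -> computable f -> computable g.
Proof. by move=> fg [h ch hP]; exists h => // a; rewrite hP fg. Qed.

Lemma comp_id : computable (fun x : X => x).
Proof. by exists id => //; apply: cmp_proj. Qed.

Lemma comp_const (c : A) : computable (fun _ : X => c).
Proof. by exists (fun=> encode c) => //; apply: fun1_const. Qed.

Lemma comp_comp (f : A -> B) (g : X -> A) :
  computable f -> computable g -> computable (fun x => f (g x)).
Proof.
case=> h ch hP [k ck kP]; exists (h \o k) => [|a /=]; first exact: cmp_ap1 ch ck.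
by rewrite kP hP.
Qed.

Lemma comp_pair (f : X -> A) (g : X -> B) :
  computable f -> computable g -> computable (fun x => (f x, g x)).
Proof.
case=> h ch hP [k ck kP]; exists (fun c => to_nat (h c, k c)) => [|a /=].
  exact: cmp_ap2 fun2_pair ch ck.
by rewrite hP kP.
Qed.

Lemma comp_fst (f : X -> A * B) : computable f -> computable (fun x => (f x).1).
Proof.
case=> h ch hP; exists (fun c => (of_nat (h c)).1) => [|a /=].
  exact: cmp_ap1 fun1_of_nat1 ch.
by rewrite hP cancel_of_to.
Qed.

Lemma comp_snd (f : X -> A * B) : computable f -> computable (fun x => (f x).2).
Proof.
case=> h ch hP; exists (fun c => (of_nat (h c)).2) => [|a /=].
  exact: cmp_ap1 fun1_of_nat2 ch.
by rewrite hP cancel_of_to.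
Qed.

Lemma comp_nat1 h (f : X -> nat) : fun1 h -> computable f -> computable (fun x => h (f x)).
Proof.
by move=> ch [g cg gP]; exists (h \o g) => [|a /=]; [exact: cmp_ap1 ch cg | rewrite gP].
Qed.

Lemma comp_if (b : X -> bool) (f g : X -> A) :
  computable b -> computable f -> computable g -> computable (fun x => if b x then f x else g x).
Proof.
case=> u cu uP [h ch hP] [k ck kP].
exists (fun c => if u c == 1 then h c else k c) => [|a].
  exact: cmp_if (cmp_ap2 fun2_eq cu (fun1_const 1)) ch ck.
by rewrite uP hP kP; case: (b a).
Qed.

Lemma comp_cons (f : X -> A) (g : X -> seq A) :
  computable f -> computable g -> computable (fun x => f x :: g x).
Proof.
case=> h ch hP [k ck kP]; exists (fun c => (to_nat (h c, k c)).+1) => [|a /=].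
  exact: cmp_ap1 fun1S (cmp_ap2 fun2_pair ch ck).
by rewrite hP kP.
Qed.

Lemma comp_case (l : X -> seq A) (f : X -> B) (g : X -> A -> seq A -> B) :
  computable l -> computable f -> computable (fun p : X * (A * seq A) => g p.1 p.2.1 p.2.2) ->
  computable (fun x => if l x is a :: s then g x a s else f x).
Proof.
case=> u cu uP [h ch hP] [k ck kP].
(* The empty list has code 0, and the code of [a :: s] is one more than that of the pair
   [(a, s)]. *)
exists (fun c => if u c == 0 then h c else k (to_nat (c, (u c).-1))) => [|x].
  apply: cmp_if (cmp_ap2 fun2_eq cu (fun1_const 0)) ch _.
  exact: cmp_ap1 ck (cmp_ap2 fun2_pair (cmp_proj _) (cmp_ap1 fun1_pred cu)).
by rewrite uP hP; case: (l x) => //= a s; rewrite -(kP (x, (a, s))).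
Qed.

(** The source of all later recursions: the code of x is the parameter of a primitive recursion,
    paired at each step with the current state. *)
Lemma comp_iter (n : X -> nat) (s : X -> A -> A) (a : X -> A) :
  computable n -> computable (fun p : X * A => s p.1 p.2) -> computable a ->
  computable (fun x => iter (n x) (s x) (a x)).
Proof.
case=> u cu uP [h ch hP] [k ck kP].
have c2 := fun2_prec (h := fun i z x => h (to_nat (x, z))) ck
  (cmp_ap1 ch (cmp_ap2 fun2_pair (cmp_proj _) (cmp_proj _))).
exists (fun c => nat_rec (fun=> nat) (k c) (fun i z => h (to_nat (c, z))) (u c)).
  exact: cmp_ap2 c2 cu (cmp_proj _).
move=> x; rewrite uP kP; rewrite [encode (n x)]/=; elim: (n x) => //= m ->.
by rewrite -(hP (x, _)).
Qed.

End Comp.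

Section CompBool.
Context (X : Type) {eX : enc X}.

Lemma comp_eq (A : eqType) {eA : enc A} (f g : X -> A) :
  computable f -> computable g -> computable (fun x => f x == g x).
Proof.
case=> u cu uP [k ck kP]; exists (fun c => (u c == k c) : nat) => [|a /=].
  exact: cmp_ap2 fun2_eq cu ck.
by rewrite uP kP (inj_eq encode_inj).
Qed.

Lemma comp_negb (b : X -> bool) : computable b -> computable (fun x => ~~ b x).
Proof. by move=> cb; apply: (comp_if cb); apply: comp_const. Qed.

Lemma comp_andb (b c : X -> bool) :
  computable b -> computable c -> computable (fun x => b x && c x).
Proof. by move=> cb cc; apply: (comp_if cb cc); apply: comp_const. Qed.

Lemma comp_orb (b c : X -> bool) :
  computable b -> computable c -> computable (fun x => b x || c x).
Proof. by move=> cb cc; apply: (comp_if cb _ cc); apply: comp_const. Qed.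

End CompBool.

(* Matching on the syntactic shape keeps unification from inventing decompositions. *)
Ltac comp_prim := lazymatch goal with
  | |- computable (fun x => x) => exact: comp_id
  | |- computable (fun _ => ?c) => apply: comp_const
  | |- computable fst => apply: (comp_fst (f := id))
  | |- computable snd => apply: (comp_snd (f := id))
  | |- computable (fun x => (@?f x).1) => apply: (comp_fst (f := f))
  | |- computable (fun x => (@?f x).2) => apply: (comp_snd (f := f))
  | |- computable (fun x => (@?f x, @?g x)) => apply: (comp_pair (f := f) (g := g))
  | |- computable (fun x => @?f x :: @?g x) => apply: (comp_cons (f := f) (g := g))
  | |- computable (fun x => @?f x == @?g x) => apply: (comp_eq (f := f) (g := g))
  | |- computable (fun x => ~~ @?b x) => apply: (comp_negb (b := b))
  | |- computable (fun x => @?b x && @?c x) => apply: (comp_andb (b := b) (c := c))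
  | |- computable (fun x => @?b x || @?c x) => apply: (comp_orb (b := b) (c := c))
  | _ => apply: comp_if
  end.
(** Redefined below as further operations become available, so that [comp] handles them too. *)
Ltac comp_step := comp_prim.
Ltac comp := repeat comp_step.

(** * Computable operations on lists *)

Section CompFoldl.
Context (X A B : Type) {eX : enc X} {eA : enc A} {eB : enc B}.

Lemma comp_foldl (l : X -> seq A) (f : X -> B -> A -> B) (b : X -> B) :
  computable l -> computable (fun p : X * (B * A) => f p.1 p.2.1 p.2.2) -> computable b ->
  computable (fun x => foldl (f x) (b x) (l x)).
Proof.
move=> cl cf cb.
(* The state is the rest of the list with the accumulator. It is stationary once the list is empty,
   so iterating [encode (l x)] times, at least once per element, gives the fold. *)
pose step x (p : seq A * B) := if p.1 is a :: s then (s, f x p.2 a) else p.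
have cstep : computable (fun p : X * (seq A * B) => step p.1 p.2).
  apply: comp_case; [by comp..|].
  pose q (p : X * (seq A * B) * (A * seq A)) := (p.1.1, (p.1.2.2, p.2.1)).
  by apply: comp_pair; [comp | apply: (comp_comp (g := q) cf); rewrite /q; comp].
have cn : computable (fun x => encode (l x)) by case: cl => u cu uP; exists u.
apply: comp_ext (comp_snd (comp_iter cn cstep (comp_pair cl cb))) => x; cbv beta.
have := size_encode (l x) (eA := eA); move: (b x) (l x) (encode (l x)) => z s n.
elim: n s z => [|n IH] [|a s] z //= sn; rewrite -iterS iterSr //=; last exact: IH.
by rewrite IH.
Qed.

End CompFoldl.

Lemma comp_rev (X A : Type) {eX : enc X} {eA : enc A} (l : X -> seq A) :
  computable l -> computable (fun x => rev (l x)).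
Proof.
move=> cl; have : computable (fun x => foldl (fun s a => a :: s) [::] (l x)).
  by apply: comp_foldl cl _ _; comp.
by apply: comp_ext => x; rewrite -[l x in LHS]revK foldl_rev; elim: (rev _) => //= a s ->.
Qed.

Section CompFoldr.
Context (X A B : Type) {eX : enc X} {eA : enc A} {eB : enc B}.

Lemma comp_foldr (l : X -> seq A) (f : X -> A -> B -> B) (b : X -> B) :
  computable l -> computable (fun p : X * (B * A) => f p.1 p.2.2 p.2.1) -> computable b ->
  computable (fun x => foldr (f x) (b x) (l x)).
Proof.
move=> cl cf cb; have := comp_foldl (f := fun x z a => f x a z) (comp_rev cl) cf cb.
by apply: comp_ext => x; rewrite foldl_rev.
Qed.

End CompFoldr.

Section CompSeq.
Context (X A B : Type) {eX : enc X} {eA : enc A} {eB : enc B}.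

Lemma comp_map (l : X -> seq A) (f : X -> A -> B) :
  computable l -> computable (fun p : X * A => f p.1 p.2) -> computable (fun x => map (f x) (l x)).
Proof.
move=> cl cf; have : computable (fun x => foldr (fun a r => f x a :: r) [::] (l x));
  last by apply: comp_ext => x; elim: (l x) => //= a s ->.
apply: comp_foldr cl _ _; comp.
by apply: (comp_comp (g := fun p : X * (seq B * A) => (p.1, p.2.2)) cf); comp.
Qed.

Lemma comp_cat (s t : X -> seq A) :
  computable s -> computable t -> computable (fun x => s x ++ t x).
Proof.
move=> cs ct; have : computable (fun x => foldr cons (t x) (s x)).
  by apply: comp_foldr cs _ ct; comp.
by apply: comp_ext => x; elim: (s x) => //= a r ->.
Qed.

Lemma comp_filter (l : X -> seq A) (f : X -> A -> bool) :
  computable l -> computable (fun p : X * A => f p.1 p.2) ->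
  computable (fun x => filter (f x) (l x)).
Proof.
move=> cl cf.
have : computable (fun x => foldr (fun a r => if f x a then a :: r else r) [::] (l x));
  last by apply: comp_ext => x; elim: (l x) => //= a s ->.
apply: comp_foldr cl _ _; comp.
by apply: (comp_comp (g := fun p : X * (seq A * A) => (p.1, p.2.2)) cf); comp.
Qed.

Lemma comp_has (l : X -> seq A) (f : X -> A -> bool) :
  computable l -> computable (fun p : X * A => f p.1 p.2) -> computable (fun x => has (f x) (l x)).
Proof.
move=> cl cf; have : computable (fun x => foldr (fun a r => f x a || r) false (l x));
  last by apply: comp_ext => x; elim: (l x) => //= a s ->.
apply: comp_foldr cl _ _; comp.
by apply: (comp_comp (g := fun p : X * (bool * A) => (p.1, p.2.2)) cf); comp.
Qed.

Lemma comp_all (l : X -> seq A) (f : X -> A -> bool) :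
  computable l -> computable (fun p : X * A => f p.1 p.2) -> computable (fun x => all (f x) (l x)).
Proof.
move=> cl cf; have := comp_negb (comp_has (f := fun x a => ~~ f x a) cl (comp_negb cf)).
by apply: comp_ext => x; rewrite -all_predC; apply: eq_all => a; rewrite /= negbK.
Qed.

End CompSeq.

Lemma comp_flatten (X A : Type) {eX : enc X} {eA : enc A} (l : X -> seq (seq A)) :
  computable l -> computable (fun x => flatten (l x)).
Proof.
move=> cl; apply: comp_foldr cl _ _; comp.
by apply: comp_cat; comp.
Qed.

Lemma comp_mem (X : Type) (A : eqType) {eX : enc X} {eA : enc A} (l : X -> seq A) a :
  computable l -> computable a -> computable (fun x => a x \in l x).
Proof.
move=> cl ca.
have : computable (fun x => has (fun b => b == a x) (l x));
  last by apply: comp_ext => x; rewrite -has_pred1.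
apply: comp_has cl _; apply: comp_eq; comp.
by apply: (comp_comp ca); comp.
Qed.

Ltac comp_seq := lazymatch goal with
  | |- computable (fun x => map (@?f x) (@?l x)) => apply: (comp_map (f := f) (l := l))
  | |- computable (fun x => filter (@?f x) (@?l x)) => apply: (comp_filter (f := f) (l := l))
  | |- computable (fun x => has (@?f x) (@?l x)) => apply: (comp_has (f := f) (l := l))
  | |- computable (fun x => all (@?f x) (@?l x)) => apply: (comp_all (f := f) (l := l))
  | |- computable (fun x => @?s x ++ @?t x) => apply: (comp_cat (s := s) (t := t))
  | |- computable (fun x => flatten (@?l x)) => apply: (comp_flatten (l := l))
  | |- computable (fun x => in_mem (@?a x) _) => apply: (comp_mem (a := a))
  | _ => comp_prim
  end.
Ltac comp_step ::= comp_seq.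

Definition sublists (A : Type) (s : seq A) : seq (seq A) :=
  foldr (fun a r => r ++ map (cons a) r) [:: [::]] s.

Lemma comp_sublists (X A : Type) {eX : enc X} {eA : enc A} (l : X -> seq A) :
  computable l -> computable (fun x => sublists (l x)).
Proof. by move=> cl; apply: comp_foldr cl _ _; comp. Qed.

Lemma mem_sublists (A : eqType) (s g : seq A) : g \in sublists s -> {subset g <= s}.
Proof.
elim: s g => [|a s IH] g /=; first by rewrite inE => /eqP ->.
rewrite mem_cat => /orP[/IH gs b /gs bs|]; first by rewrite inE bs orbT.
by move=> /mapP[r /IH rs ->] b; rewrite !inE => /predU1P[->|/rs ->]; rewrite ?eqxx ?orbT.
Qed.

(** Hence [sublists s] represents every subset of [s]; in this way all goal sets get enumerated. *)
Lemma filter_sublists (A : eqType) (p : pred A) (s : seq A) : filter p s \in sublists s.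
Proof.
elim: s => //= a s IH; rewrite mem_cat; case: ifP => _; last by rewrite IH.
by rewrite map_f ?orbT.
Qed.

Lemma map_sublists (A B : Type) (f : A -> B) s :
  sublists (map f s) = map (map f) (sublists s).
Proof. by elim: s => //= a s ->; rewrite map_cat -!map_comp. Qed.

(** * Recursion bounded by fuel *)

Section FuelRecursion.
Context (A : eqType) {eA : enc A} (d : A -> seq A) (h : A -> seq bool -> bool).

(** [d a] lists the arguments of the recursive calls and [h] combines their answers. *)
Fixpoint frec n a := if n is n'.+1 then h a (map (frec n') (d a)) else false.

Definition reach n a := iter n (fun l => flatten [seq x :: d x | x <- l]) [:: a].

Definition truths n a :=
  iter n (fun T => [seq x <- reach n a | h x [seq y \in T | y <- d x]]) [::].

Lemma reach_step n a x : x \in reach n a -> {subset x :: d x <= reach n.+1 a}.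
Proof. by move=> xr y yx; apply/flattenP; exists (x :: d x) => //; apply: map_f. Qed.

Lemma reach_mono m n a : m <= n -> {subset reach m a <= reach n a}.
Proof.
move=> /subnK <-; elim: (n - m) => // k IH x /IH xr.
by apply: (reach_step xr); rewrite inE eqxx.
Qed.

(** After j rounds the table is right at depth up to n - j: the calls made there lie one level
    deeper, where it was already right after j - 1 rounds. *)
Lemma truthsP n a j i x : i + j <= n -> x \in reach i a ->
  (x \in iter j (fun T => [seq x <- reach n a | h x [seq y \in T | y <- d x]]) [::])
  = frec j x.
Proof.
elim: j i x => // j IH i x ij xr; rewrite iterS mem_filter (reach_mono _ xr) ?andbT.
  rewrite /=; congr h; apply/eq_in_map => y yd; apply: (IH i.+1); first by lia.
  by apply: (reach_step xr); rewrite inE yd orbT.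
by lia.
Qed.

(* Recursive calls change all arguments, so primitive recursion tabulates instead,
   for increasing fuel, the truth values on the arguments reachable from a. *)
Lemma frecE n a : frec n a = (a \in truths n a).
Proof. by rewrite /truths (@truthsP n a n 0) ?inE. Qed.

Lemma comp_frec : computable d -> computable (fun p : A * seq bool => h p.1 p.2) ->
  computable (fun p : nat * A => frec p.1 p.2).
Proof.
move=> cd ch; apply: comp_ext (fun p => esym (frecE _ _)) _.
have cr : computable (fun p : nat * A => reach p.1 p.2).
  apply: comp_iter; comp.
  by apply: (comp_comp cd); comp.
apply: comp_mem; last by comp.
apply: comp_iter; comp.
  by apply: (comp_comp (g := fun p : nat * A * seq A => p.1) cr); comp.
pose q (p : nat * A * seq A * A) := (p.2, [seq y \in p.1.2 | y <- d p.2]).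
apply: (comp_comp (g := q) ch); rewrite /q; comp.
by apply: (comp_comp cd); comp.
Qed.

End FuelRecursion.

(** * Types of sums *)

(** The label is the number of the constructor: 1, 2, 3 for the atoms [FLt], [FEq], [FIn], then 4
    for [FNot], 5 for [FAnd], 7 for [FEx1] and 8 for [FEx2]. *)
Definition label c := (of_nat c).1.
Definition arg c := (of_nat c).2.
Definition arg1 c := label (arg c).
Definition arg2 c := arg (arg c).

Lemma label_to_nat x y : label (to_nat (x, y)) = x.
Proof. by rewrite /label cancel_of_to. Qed.

Lemma arg_to_nat x y : arg (to_nat (x, y)) = y.
Proof. by rewrite /arg cancel_of_to. Qed.

Lemma comp_label (X : Type) {eX : enc X} (f : X -> nat) :
  computable f -> computable (fun x => label (f x)).
Proof. exact: comp_nat1 fun1_of_nat1. Qed.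

Lemma comp_arg (X : Type) {eX : enc X} (f : X -> nat) :
  computable f -> computable (fun x => arg (f x)).
Proof. exact: comp_nat1 fun1_of_nat2. Qed.

Lemma comp_arg1 (X : Type) {eX : enc X} (f : X -> nat) :
  computable f -> computable (fun x => arg1 (f x)).
Proof. by move=> cf; apply: comp_label (comp_arg cf). Qed.

Lemma comp_arg2 (X : Type) {eX : enc X} (f : X -> nat) :
  computable f -> computable (fun x => arg2 (f x)).
Proof. by move=> cf; apply: comp_arg (comp_arg cf). Qed.

Ltac comp_code := lazymatch goal with
  | |- computable (fun x => label (@?f x)) => apply: (comp_label (f := f))
  | |- computable (fun x => arg (@?f x)) => apply: (comp_arg (f := f))
  | |- computable (fun x => arg1 (@?f x)) => apply: (comp_arg1 (f := f))
  | |- computable (fun x => arg2 (@?f x)) => apply: (comp_arg2 (f := f))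
  | _ => comp_seq
  end.
Ltac comp_step ::= comp_code.

(** * Reading the conjuncts of a type off its code *)

Definition conj_step (p : nat * seq nat) :=
  if label p.1 == 5 then (arg2 p.1, arg1 p.1 :: p.2) else p.

(** The code of a formula bounds the number of its conjuncts, and [conj_step] is stationary when
    none is left. *)
Definition conjs c := (iter c conj_step (c, [::])).2.

Lemma comp_conjs (X : Type) {eX : enc X} (f : X -> nat) :
  computable f -> computable (fun x => conjs (f x)).
Proof.
move=> cf; apply: comp_snd; apply: (comp_iter (s := fun _ => conj_step)); [exact: cf| |by comp].
by rewrite /conj_step; comp.
Qed.

(** [signed_conjs] nests to the right; the dropped last conjunct is its terminator [FNot FFalse]. *)
Fixpoint lits m k (phi : mlo m k) : seq (mlo m k) :=
  if phi is FAnd p q then p :: lits q else [::].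

Lemma size_lits m k (phi : mlo m k) : size (lits phi) <= code phi.
Proof.
elim: phi => //= {}m {}k p _ q IH.
have := leq_to_nat 5 (to_nat (code p, code q)); have := leq_to_nat (code p) (code q); lia.
Qed.

Lemma iter_conj_step m k (phi : mlo m k) n acc : size (lits phi) <= n ->
  (iter n conj_step (code phi, acc)).2 = rev (map (@code m k) (lits phi)) ++ acc.
Proof.
have stop c r j : label c != 5 -> iter j conj_step (c, r) = (c, r).
  by move=> c5; elim: j => //= j ->; rewrite /conj_step (negPf c5).
elim: phi n acc =>
  [? ?|? ? i j|? ? i j|? ? i j|? ? p _|{}m {}k p _ q IH|? ? p _ q _|? ? p _|? ? p _]
  n acc /=; try by rewrite stop ?label_to_nat.
case: n => // n sn; rewrite iterSr {2}/conj_step /= label_to_nat /=.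
by rewrite /arg1 /arg2 !arg_to_nat label_to_nat IH // rev_cons cat_rcons.
Qed.

Lemma mem_conjs m k (phi : mlo m k) : conjs (code phi) =i map (@code m k) (lits phi).
Proof. by move=> c; rewrite /conjs iter_conj_step ?size_lits // cats0 mem_rev. Qed.

Section SignedConjsLits.
Variables (m k : nat) (M : chain) (e : 'I_m -> M) (v : 'I_k -> set M).

Lemma signed_conjs_lits (s : seq (mlo m k)) t c :
  t \in signed_conjs s -> sat t e v -> c \in lits t ->
  (c \in s /\ sat c e v) \/ exists p, c = FNot p.
Proof.
elim: s t => [|b s IH] t /=; first by rewrite inE => /eqP ->.
rewrite mem_cat => /orP[]/mapP[r rs ->] /= [hb sr]; rewrite inE => /predU1P[->|ct].
- by left; rewrite inE eqxx.
- by have [[cs sc]|] := IH r rs sr ct; [left; rewrite inE cs orbT | right].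
- by right; exists b.
- by have [[cs sc]|] := IH r rs sr ct; [left; rewrite inE cs orbT | right].
Qed.

Lemma lits_signed_conjs (s : seq (mlo m k)) t b :
  t \in signed_conjs s -> sat t e v -> b \in s -> sat b e v -> b \in lits t.
Proof.
elim: s t => // b' s IH t /=.
by rewrite mem_cat => /orP[]/mapP[r rs ->] /= [hb sr]; rewrite !inE => /predU1P[->|bs] sb;
  rewrite ?eqxx ?(IH r) ?orbT.
Qed.

(** A satisfied signed conjunction contains [b] if [b] is true and [FNot b] otherwise. The condition
    on the label keeps [b] itself from being the negation of another constituent. *)
Lemma code_conjs (s : seq (mlo m k)) t b :
  t \in signed_conjs s -> sat t e v -> b \in s -> label (code b) != 4 ->
  code b \in conjs (code t) <-> sat b e v.
Proof.
move=> ts st bs b4; rewrite mem_conjs; split=> [/mapP[c ct /code_inj bc]|sb].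
  have [[_]|[p cp]] := signed_conjs_lits ts st ct; first by rewrite bc.
  by move: b4; rewrite bc cp /= label_to_nat.
exact/map_f/(lits_signed_conjs ts).
Qed.

End SignedConjsLits.

(** In a satisfied type of depth n + 1 these are the types of depth n realized by adding a point (j
    = 7) or a set (j = 8). *)
Definition bodies j c := [seq arg l | l <- conjs c & label l == j].

Lemma comp_bodies j (X : Type) {eX : enc X} (f : X -> nat) :
  computable f -> computable (fun x => bodies j (f x)).
Proof. by move=> cf; rewrite /bodies;comp; apply: comp_conjs; comp. Qed.

Ltac comp_step ::= lazymatch goal with
  | |- computable (fun x => conjs (@?f x)) => apply: (comp_conjs (f := f))
  | |- computable (fun x => bodies _ _) => apply: comp_bodies
  | |- computable (fun x => (@?f x).+1) => apply: (comp_nat1 (f := f) fun1S)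
  | _ => comp_code
  end.

Section Bodies.
Variables (n m k : nat) (M : chain) (e : 'I_m -> M) (v : 'I_k -> set M) (t : mlo m k).
Hypotheses (tC : t \in Char n.+1 m k) (st : sat t e v).

Lemma bodies7 c : c \in bodies 7 (code t) <->
  exists p, [/\ p \in Char n m.+1 k, c = code p & sat (FEx1 p) e v].
Proof.
split=> [/mapP[l]|[p [pC -> sp]]].
  rewrite mem_filter mem_conjs => /andP[/eqP l7 /mapP[q qt lq]] ->.
  have [[qs sq]|[p qp]] := signed_conjs_lits tC st qt; last first.
    by move: l7; rewrite lq qp /= label_to_nat.
  move: qs sq l7; rewrite lq mem_cat => /orP[]/mapP[p pC ->] sp /=;
    rewrite label_to_nat // arg_to_nat => _; by exists p.
have -> : code p = arg (code (@FEx1 m k p)) by rewrite /= arg_to_nat.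
apply: map_f; rewrite mem_filter; apply/andP; split; first by rewrite /= label_to_nat.
by apply/(code_conjs tC st); rewrite ?mem_cat ?map_f //= label_to_nat.
Qed.

Lemma bodies8 c : c \in bodies 8 (code t) <->
  exists p, [/\ p \in Char n m k.+1, c = code p & sat (FEx2 p) e v].
Proof.
split=> [/mapP[l]|[p [pC -> sp]]].
  rewrite mem_filter mem_conjs => /andP[/eqP l7 /mapP[q qt lq]] ->.
  have [[qs sq]|[p qp]] := signed_conjs_lits tC st qt; last first.
    by move: l7; rewrite lq qp /= label_to_nat.
  move: qs sq l7; rewrite lq mem_cat => /orP[]/mapP[p pC ->] sp /=;
    rewrite label_to_nat // arg_to_nat => _; by exists p.
have -> : code p = arg (code (@FEx2 m k p)) by rewrite /= arg_to_nat.
apply: map_f; rewrite mem_filter; apply/andP; split; first by rewrite /= label_to_nat.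
by apply/(code_conjs tC st); rewrite ?mem_cat ?map_f ?orbT //= label_to_nat.
Qed.

End Bodies.

(* A query ((rho, tau, sigma), (m, L)) asks whether rho holds in a sum whose summands
   satisfy tau and sigma.  All three formulas have m individual variables: t_i denotes
   the point chosen in the left summand if i is in L and in the right one otherwise,
   and the point chosen in the other summand is a dummy. *)
Definition query := (nat * nat * nat * (nat * seq nat))%type.

(** For a point quantifier each summand gets a new point, and the two calls differ in which of the
    two is the witness. For a set quantifier the witness consists of a set in each summand, so every
    pair of bodies gives one call. *)
Definition calls (q : query) : seq query :=
  let rho := q.1.1.1 in let tau := q.1.1.2 in let sigma := q.1.2 in
  let m := q.2.1 in let L := q.2.2 in
  if label rho == 4 then [:: (arg rho, tau, sigma, (m, L))] else
  if label rho == 5 then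
    [:: (arg1 rho, tau, sigma, (m, L)); (arg2 rho, tau, sigma, (m, L))] else
  if label rho == 7 then
    flatten [seq flatten
      [seq [:: (arg rho, t, t', (m.+1, m :: L)); (arg rho, t, t', (m.+1, L))]
      | t' <- bodies 7 sigma] | t <- bodies 7 tau] else
  if label rho == 8 then
    flatten [seq [seq (arg rho, t, t', (m, L)) | t' <- bodies 8 sigma]
            | t <- bodies 8 tau]
  else [::].

(** An atom about a single summand is a conjunct of the type of that summand or false. Across the
    summands no equality holds, and the order holds exactly from left to right. *)
Definition answer (q : query) (r : seq bool) : bool :=
  let rho := q.1.1.1 in let tau := q.1.1.2 in let sigma := q.1.2 in
  let L := q.2.2 in
  let atom := rho \in conjs (if arg1 rho \in L then tau else sigma) in
  if label rho == 4 then ~~ has id r else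
  if label rho == 5 then all id r else
  if label rho == 3 then atom else
  if (label rho == 1) || (label rho == 2) then
    if (arg1 rho \in L) == (arg2 rho \in L) then atom
    else (label rho == 1) && (arg1 rho \in L)
  else has id r.

Definition sum_sat := frec calls answer.

Lemma comp_sum_sat : computable (fun p : nat * query => sum_sat p.1 p.2).
Proof. by apply: comp_frec; rewrite /calls /answer; comp. Qed.

Local Open Scope classical_set_scope.

Section Sums.
Variables a b : wellorder.

Definition sum_set (X : set a) (Y : set b) : set (oadd a b) :=
  fun z => match z with inl x => X x | inr y => Y y end.

Definition sum_env k (v : 'I_k -> set a) (w : 'I_k -> set b) : 'I_k -> set (oadd a b) :=
  fun j => sum_set (v j) (w j).

Definition sum_points m (L : seq nat) (e : 'I_m -> a) (e' : 'I_m -> b) :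
  'I_m -> oadd a b := fun i => if (i : nat) \in L then inl (e i) else inr (e' i).

Lemma sum_set_preim (X : set (oadd a b)) :
  sum_set (fun x => X (inl x)) (fun y => X (inr y)) = X.
Proof. by apply: funext => -[]. Qed.

Lemma clt_inl (x y : a) : clt (inl x : oadd a b) (inl y) <-> clt x y.
Proof. by split=> [h|h]; [inversion h | constructor]. Qed.

Lemma clt_inr (x y : b) : clt (inr x : oadd a b) (inr y) <-> clt x y.
Proof. by split=> [h|h]; [inversion h | constructor]. Qed.

Lemma clt_inl_inr (x : a) (y : b) : clt (inl x : oadd a b) (inr y).
Proof. by constructor. Qed.

Lemma clt_inr_inl (x : a) (y : b) : ~ clt (inr y : oadd a b) (inl x).
Proof. by move=> h; inversion h. Qed.

Lemma ext_sum_env k (v : 'I_k -> set a) (w : 'I_k -> set b) X Y :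
  ext (sum_env v w) (sum_set X Y) = sum_env (ext v X) (ext w Y).
Proof. by apply: funext => j; rewrite /sum_env /ext; case: unliftP. Qed.

Section Points.
Variables (m : nat) (L : seq nat) (e : 'I_m -> a) (e' : 'I_m -> b) (x : a) (y : b).
Hypothesis Lm : forall i, i \in L -> i < m.

Lemma ext_sum_inl :
  ext (sum_points L e e') (inl x) = sum_points (m :: L) (ext e x) (ext e' y).
Proof.
apply: funext => i; rewrite /sum_points /ext; case: unliftP => [j ->|->].
  by rewrite lift_max inE ltn_eqF.
by rewrite inE eqxx.
Qed.

Lemma ext_sum_inr :
  ext (sum_points L e e') (inr y) = sum_points L (ext e x) (ext e' y).
Proof.
apply: funext => i; rewrite /sum_points /ext; case: unliftP => [j ->|->].
  by rewrite lift_max.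
by case: ifP => // /Lm; rewrite ltnn.
Qed.

End Points.

Section Queries.
Variables (m k : nat) (tau sigma : mlo m k) (L : seq nat).
Variables (e : 'I_m -> a) (v : 'I_k -> set a) (e' : 'I_m -> b) (v' : 'I_k -> set b).
Implicit Types phi : mlo m k.

Let query_sat f phi := sum_sat f (code phi, code tau, code sigma, (m, L)).
Let satp phi := sat (M := oadd a b) phi (sum_points L e e') (sum_env v v').

(** Each connective costs one unit of fuel and strictly increases the code, so fuel bounded below by
    the code reaches all constituents, where the hypothesis takes over. *)
Lemma sum_sat_signed_conjs (s : seq (mlo m k)) rho f :
  (forall c f, c \in s -> code c <= f -> query_sat f c <-> satp c) ->
  rho \in signed_conjs s -> code rho <= f -> query_sat f rho <-> satp rho.
Proof.
have stepN f' c : query_sat f'.+1 (FNot c) = ~~ query_sat f' c.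
  rewrite /query_sat /sum_sat /= /answer /calls /=.
  by rewrite label_to_nat arg_to_nat /= orbF.
(* Without fuel the answer is false, so even the true formula ending the conjunction needs one
   unit. *)
have step1 f' : query_sat f' (FNot FFalse) <-> f' != 0.
  case: f' => // f'; rewrite stepN; by case: f'.
have stepA f' c c' : query_sat f'.+1 (FAnd c c') = query_sat f' c && query_sat f' c'.
  rewrite /query_sat /sum_sat /= /answer /calls /=.
  by rewrite label_to_nat /arg1 /arg2 arg_to_nat label_to_nat arg_to_nat /= andbT.
move=> base; elim: s base rho f => [|c s IH] base rho f /=.
  rewrite inE => /eqP -> cf; rewrite step1; split=> [_ []|_].
  by rewrite -lt0n; apply: leq_trans cf; rewrite /= to_natE.
have {}IH := IH (fun d f ds => base d f (mem_behead (s := c :: s) ds)).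
have cbase f' := base c f' (mem_head _ _).
have lt i j : j < to_nat (i.+1, j) by apply: leq_trans (leq_to_nat _ _); lia.
have ltA (p q : mlo m k) : code p + code q < code (FAnd p q).
  apply: leq_trans (lt 4 _); rewrite ltnS addnC; exact: leq_to_nat.
have ltN (p : mlo m k) : code p < code (FNot p) by apply: lt.
rewrite mem_cat => /orP[]/mapP[r rs ->] cf.
- have := ltA c r; case: f cf => [|f] cf h; first by lia.
  have h1 : query_sat f c <-> satp c by apply: cbase; lia.
  have h2 : query_sat f r <-> satp r by apply: IH => //; lia.
  by rewrite stepA; split=> [/andP[/h1 ? /h2]|[/h1 -> /h2 ->]].
(* A negated conjunct spends two units, on [FAnd] and on [FNot]. *)
- have := ltA (FNot c) r; have := ltN c; case: f cf => [|[|f]] cf h h'; try by lia.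
  have h1 : query_sat f c <-> satp c by apply: cbase; lia.
  have h2 : query_sat f.+1 r <-> satp r by apply: IH => //; lia.
  rewrite stepA stepN; split=> [/andP[/negP nc /h2 sr]|[nc /h2 ->]].
    by split=> // /h1.
  by rewrite andbT; apply/negP => /h1.
Qed.

End Queries.
End Sums.

(** * The composition theorem *)

Section Composition.
Variables a b : wellorder.
Hypotheses (a0 : inhabited a) (b0 : inhabited b).

Lemma sum_sat_atom m k (tau sigma c : mlo m k) L e v e' v' f :
  tau \in Char 0 m k -> sat (M := a) tau e v ->
  sigma \in Char 0 m k -> sat (M := b) sigma e' v' ->
  c \in atoms m k -> code c <= f ->
  sum_sat f (code c, code tau, code sigma, (m, L)) <->
  sat (M := oadd a b) c (sum_points L e e') (sum_env v v').
Proof.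
move=> tC st sC ss cA cf.
have ct := code_conjs tC st cA; have cs := code_conjs sC ss cA.
have [f' fE] : exists f', f = f'.+1.
  case: f cf => [|f' _]; last by exists f'.
  move: cA; rewrite !mem_cat => /or3P[] /allpairsP[[i j] [_ _ ->]] /=;
  by rewrite leqNgt (leq_trans _ (leq_to_nat _ _)) // addnC.
rewrite {}fE /sum_sat /= /answer /=; move: cA ct cs {cf}.
rewrite !mem_cat => /or3P[] /allpairsP[[i j] [_ _ ->]].
- rewrite [label _]/= !label_to_nat => /(_ isT) ct /(_ isT) cs /=.
  rewrite ?label_to_nat /arg1 /arg2 /= !arg_to_nat !label_to_nat /=.
  rewrite /sum_points; case: ((i : nat) \in L); case: ((j : nat) \in L) => /=.
  + exact: iff_trans ct (iff_sym (@clt_inl a b _ _)).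
  + by split=> // _; exact: (@clt_inl_inr a b).
  + by split=> // /(@clt_inr_inl a b).
  + exact: iff_trans cs (iff_sym (@clt_inr a b _ _)).
- rewrite [label _]/= !label_to_nat => /(_ isT) ct /(_ isT) cs /=.
  rewrite ?label_to_nat /arg1 /arg2 /= !arg_to_nat !label_to_nat /=.
  rewrite /sum_points; case: ((i : nat) \in L); case: ((j : nat) \in L) => /=.
  + by apply: (iff_trans ct); split=> [/= ->|[]].
  + by [].
  + by [].
  + by apply: (iff_trans cs); split=> [/= ->|[]].
- rewrite [label _]/= !label_to_nat => /(_ isT) ct /(_ isT) cs /=.
  rewrite ?label_to_nat /arg1 /= !arg_to_nat !label_to_nat /=.
  by rewrite /sum_points /sum_env; case: ifP => iL.
Qed.

(** By induction on the depth. A witness in the sum restricts to the summands, where the extended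
    structures have types listed among the bodies of tau and sigma. Conversely, bodies chosen
    independently on the two sides have witnesses that combine to one in the sum. *)
Lemma sum_satP n m k (tau sigma rho : mlo m k) L e v e' v' f :
  (forall i, i \in L -> i < m) ->
  tau \in Char n m k -> sat (M := a) tau e v ->
  sigma \in Char n m k -> sat (M := b) sigma e' v' ->
  rho \in Char n m k -> code rho <= f ->
  sum_sat f (code rho, code tau, code sigma, (m, L)) <->
  sat (M := oadd a b) rho (sum_points L e e') (sum_env v v').
Proof.
elim: n m k tau sigma rho L e v e' v' f => [|n IH] m k tau sigma rho L e v e' v' f
  Lm tC st sC ss.
  apply: sum_sat_signed_conjs => c {}f; exact: sum_sat_atom.
apply: sum_sat_signed_conjs => c {}f.
(* [x0] and [y0] are the dummies for the summand that does not contain the witness. *)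
case: a0 b0 => x0 [y0].
have lt i j g : to_nat (i.+1, j) <= g.+1 -> j <= g.
  by move=> h; have := leq_trans (leq_to_nat _ _) h; lia.
rewrite mem_cat => /orP[]/mapP[t tn ->] cf; (case: f cf => [|f] cf;
  first by move: cf; rewrite /= leqNgt (leq_trans _ (leq_to_nat _ _)) // addnC).
- rewrite /sum_sat /= /answer /calls /= label_to_nat arg_to_nat /= -/sum_sat has_map.
  have {}cf := lt _ _ _ cf.
  split=> [/hasP[q /flattenP[_ /mapP[t1 + ->]] /flattenP[_ /mapP[t2 + ->]]]|[z]].
    move=> /(bodies7 tC st)[p1 [p1C -> [x sp1]]] /(bodies7 sC ss)[p2 [p2C -> [y sp2]]].
    rewrite !inE => /orP[]/eqP -> /(IH _ _ _ _ _ _ _ _ _ _ _ _ p1C sp1 p2C sp2 tn cf) H.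
    + exists (inl x); rewrite (ext_sum_inl _ _ _ _ y); apply: H.
      by move=> i; rewrite inE => /predU1P[->|/Lm /ltnW]; rewrite ?ltnS.
    + by exists (inr y); rewrite (ext_sum_inr _ _ x) //; apply: H => i /Lm /ltnW.
  (* Both positions of the witness are treated at once: [L'] contains m exactly when the witness is
     [x]. *)
  have key x y L' : (forall i, i \in L' -> i < m.+1) -> L' = m :: L \/ L' = L ->
      sat (M := oadd a b) t (sum_points L' (ext e x) (ext e' y)) (sum_env v v') ->
      has (sum_sat f \o id) (flatten [seq flatten
        [seq [:: (code t, t1, t2, (m.+1, m :: L)); (code t, t1, t2, (m.+1, L))]
        | t2 <- bodies 7 (code sigma)] | t1 <- bodies 7 (code tau)]).
    move=> L'm LL'; have [p1 p1C sp1] := Char_ex n (ext e x) v.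
    have [p2 p2C sp2] := Char_ex n (ext e' y) v'.
    move=> /(IH _ _ _ _ _ _ _ _ _ _ _ L'm p1C sp1 p2C sp2 tn cf) H.
    apply/hasP; exists (code t, code p1, code p2, (m.+1, L')) => //.
    apply/flattenP; eexists; first by apply: map_f;
      apply/(bodies7 tC st); exists p1; split=> //; exists x.
    apply/flattenP; eexists; first by apply: map_f;
      apply/(bodies7 sC ss); exists p2; split=> //; exists y.
    by case: LL' => ->; rewrite !inE eqxx ?orbT.
  case: z => [x|y].
    rewrite (ext_sum_inl _ _ _ _ y0); apply: key; last by left.
    by move=> i; rewrite inE => /predU1P[->|/Lm /ltnW]; rewrite ?ltnS.
  by rewrite (ext_sum_inr _ _ x0) //; apply: key; [move=> i /Lm /ltnW | right].
- rewrite /sum_sat /= /answer /calls /= label_to_nat arg_to_nat /= -/sum_sat has_map.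
  have {}cf := lt _ _ _ cf.
  split=> [/hasP[q /flattenP[_ /mapP[t1 + ->]] /mapP[t2 + ->]]|[Z]].
    move=> /(bodies8 tC st)[p1 [p1C -> [X sp1]]] /(bodies8 sC ss)[p2 [p2C -> [Y sp2]]].
    move=> /(IH _ _ _ _ _ _ _ _ _ _ _ Lm p1C sp1 p2C sp2 tn cf) H.
    by exists (sum_set X Y); rewrite ext_sum_env.
  rewrite -(sum_set_preim Z) ext_sum_env.
  set X := (fun x => Z (inl x)); set Y := (fun y => Z (inr y)).
  have [p1 p1C sp1] := Char_ex n e (ext v X).
  have [p2 p2C sp2] := Char_ex n e' (ext v' Y).
  move=> /(IH _ _ _ _ _ _ _ _ _ _ _ Lm p1C sp1 p2C sp2 tn cf) H.
  apply/hasP; exists (code t, code p1, code p2, (m, L)) => //.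
  apply/flattenP; eexists; first by apply: map_f;
      apply/(bodies8 tC st); exists p1; split=> //; exists X.
  by apply: map_f; apply/(bodies8 sC ss); exists p2; split=> //; exists Y.
Qed.

End Composition.

(** * Games on sums *)

Lemma setI_agree T (D X Y : set T) :
  X `&` D = Y `&` D <-> forall x, D x -> (X x <-> Y x).
Proof.
split=> [XY x Dx|XY].
  have : (X `&` D) x <-> (Y `&` D) x by rewrite XY.
  by rewrite /setI /=; tauto.
by apply: funext => x; apply: propext; split=> -[h Dx]; split=> //; apply/(XY x Dx).
Qed.

Section GameOn.
Variable g : wellorder.
Implicit Type W : set g -> set g -> Prop.

(** The winning condition is an arbitrary relation, because on a it will be a statement about the
    game that remains on b. *)
Definition won_I W := exists2 f, strongly_causal f & forall Q, W (f Q) Q.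
Definition won_II W := exists2 f, causal f & forall P, ~ W P (f P).

(** Played against each other, the two strategies yield one play that each of them would win. *)
Lemma won_I_II W : won_I W -> won_II W -> False.
Proof.
move=> [f fc fW] [h hc hW].
(* Q is Player II's side of the play in which both follow these strategies. *)
pose F x (rec : forall y : g, clt y x -> Prop) :=
  h (f [set y | exists yx : clt y x, rec y yx]) x.
pose Q : set g := Fix (clt_wf (w := g)) (fun=> Prop) F.
have QE x : Q x = h (f [set y | clt y x /\ Q y]) x.
  rewrite {1}/Q Fix_eq -/Q /F; last first.
    by move=> z r s rs; congr (h (f _) z); apply: funext => y; apply: propext;
      split=> -[yz]; exists yz; rewrite ?rs // -rs.
  congr (h (f _) x); apply: funext => y; apply: propext.
  by split=> [[yx Qy]|[yx Qy]]; [split | exists yx].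
suff hQ : h (f Q) = Q by apply: (hW (f Q)); rewrite hQ; apply: fW.
apply: funext => x; rewrite QE; apply: propext.
(* The moves of [f] up to x depend only on Q below x, and those of [h] at x only on the moves of [f]
   up to x. *)
have /hc/setI_agree H : f Q `&` upto x = f [set y | clt y x /\ Q y] `&` upto x.
  by apply/fc/setI_agree => y yx; split=> [Qy|[]].
by apply: H; right.
Qed.

End GameOn.

Section GameSum.
Variables a b : wellorder.
Implicit Type W : set (oadd a b) -> set (oadd a b) -> Prop.

Definition lpart (Z : set (oadd a b)) : set a := fun x => Z (inl x).
Definition rpart (Z : set (oadd a b)) : set b := fun y => Z (inr y).

(** Once the rounds of a are over, all of Q is known, so the strategy followed on b may depend on
    it. *)
Lemma won_I_sum W :
  won_I (fun P Q => won_I (fun P' Q' => W (sum_set P P') (sum_set Q Q'))) -> won_I W.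
Proof.
move=> [f fc fW].
have /choice[h hP] : forall Q, exists h, strongly_causal h /\
    forall Q', W (sum_set (f Q) (h Q')) (sum_set Q Q').
  by move=> Q; have [h hc hW] := fW Q; exists h.
exists (fun Z => sum_set (f (lpart Z)) (h (lpart Z) (rpart Z))); last first.
  by move=> Z; rewrite -{4}(sum_set_preim Z); apply: (hP _).2.
move=> d Z Z' /setI_agree ZZ'; apply/setI_agree => z zd.
case: z d zd ZZ' => [x|y] d zd ZZ'.
(* Agreement below x suffices, and x is at or before [d] whichever summand contains [d]. *)
- have /fc/setI_agree H : lpart Z `&` below x = lpart Z' `&` below x.
    apply/setI_agree => y yx; apply: ZZ'.
    by case: zd => [|<-]; [apply: clt_trans|]; apply/clt_inl.
  by apply: H; right.
- case: d zd ZZ' => [x|d] zd ZZ'; first by case: zd => // /(@clt_inr_inl a b).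
  (* All of a precedes [d], so the plays agree on a and the same strategy is chosen on b. *)
  have -> : lpart Z = lpart Z'.
    by apply: funext => x; apply: propext; apply: ZZ'; apply: (@clt_inl_inr a b).
  have /(hP (lpart Z')).1/setI_agree H : rpart Z `&` below d = rpart Z' `&` below d.
    by apply/setI_agree => y' yd; apply: ZZ'; apply/clt_inr.
  by apply: H; case: zd => [/(@clt_inr a b)|[]]; [left|right].
Qed.

(** With the negated inner game as condition, Player II wins on a by reaching a play after which
    Player II also wins on b. *)
Lemma won_II_sum W :
  won_II (fun P Q => ~ won_II (fun P' Q' => W (sum_set P P') (sum_set Q Q'))) -> won_II W.
Proof.
move=> [f fc fW].
have /choice[h hP] : forall P, exists h, causal h /\
    forall P', ~ W (sum_set P P') (sum_set (f P) (h P')).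
  by move=> P; have /contrapT[h hc hW] := fW P; exists h.
exists (fun Z => sum_set (f (lpart Z)) (h (lpart Z) (rpart Z))); last first.
  by move=> Z; rewrite -{1}(sum_set_preim Z); apply: (hP _).2.
move=> d Z Z' /setI_agree ZZ'; apply/setI_agree => z zd.
case: z d zd ZZ' => [x|y] d zd ZZ'.
- have /fc/setI_agree H : lpart Z `&` upto x = lpart Z' `&` upto x.
    apply/setI_agree => y [yx|->]; apply: ZZ' => //; left.
    by case: zd => [|<-]; [apply: clt_trans|]; apply/clt_inl.
  by apply: H; right.
- case: d zd ZZ' => [x|d] zd ZZ'; first by case: zd => // /(@clt_inr_inl a b).
  have -> : lpart Z = lpart Z'.
    by apply: funext => x; apply: propext; apply: ZZ'; left; apply: (@clt_inl_inr a b).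
  have /(hP (lpart Z')).1/setI_agree H : rpart Z `&` upto d = rpart Z' `&` upto d.
    apply/setI_agree => y' yd; apply: ZZ'.
    by case: yd => [yd|->]; [left; apply/clt_inr|right].
  by apply: H; case: zd => [/(@clt_inr a b)|[]]; [left|right].
Qed.

End GameSum.

(** * Goal sets and game types of a sum *)

Lemma holds_disj g (G : {fset mlo 0 2}) (P Q : set (ochain g)) :
  holds (disj G) P Q <-> exists2 t, t \in G & holds t P Q.
Proof.
have -> : (exists2 t, t \in G & holds t P Q) = exists2 t, t \in enum_fset G & holds t P Q by [].
rewrite /disj; elim: (enum_fset G) => [|t s IH] /=; first by split=> // -[].
split=> [[st|/IH[t' ts st']]|[t' +]].
- by exists t => //; rewrite inE eqxx.
- by exists t' => //; rewrite inE ts orbT.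
- rewrite inE => /predU1P[->|ts st']; first by left.
  by right; apply/IH; exists t'.
Qed.

Lemma Char_holds n g (P Q : set (ochain g)) : exists2 t, t \in Char n 0 2 & holds t P Q.
Proof. exact: Char_ex. Qed.

(** [rho] is also the fuel, as much as [sum_satP] asks for. A sentence has no point variables, hence
    m = 0 and the empty list. *)
Definition sum_type rho tau sigma := sum_sat rho (rho, tau, sigma, (0, [::])).

Section SumGame.
Variables (a b : wellorder) (n : nat).
Hypotheses (a0 : inhabited a) (b0 : inhabited b) (da : determinate a) (db : determinate b).

Lemma sum_typeP (tau sigma rho : mlo 0 2) (P Q : set a) (P' Q' : set b) :
  tau \in Char n 0 2 -> sigma \in Char n 0 2 -> rho \in Char n 0 2 ->
  holds tau P Q -> holds sigma P' Q' ->
  sum_type (code rho) (code tau) (code sigma) <->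
  holds rho (sum_set P P') (sum_set Q Q').
Proof.
move=> tC sC rC st ss; have := sum_satP (f := code rho) a0 b0 _ tC st sC ss rC (leqnn _).
move=> /(_ [::] (fun i => _)) H; apply: (iff_trans (H _)) => //.
rewrite /holds; have -> : sum_points [::] (@no_points a) (@no_points b) = @no_points (oadd a b).
  by apply: funext => -[].
set v := sum_env _ _; set w := fun i => _; suff -> : v = w by [].
by apply: funext => i; rewrite /v /w /sum_env; case: ifP.
Qed.

(** [B tau] is the goal left on b after a play of type tau on a. It is instantiated semantically to
    get determinacy, and through [sum_type] to compute the game type. *)
Variables (phi : mlo 0 2) (B : mlo 0 2 -> {fset mlo 0 2}).
Hypothesis BP : forall tau (P Q : set a) (P' Q' : set b),
  tau \in Char n 0 2 -> holds tau P Q ->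
  holds (disj (B tau)) P' Q' <-> holds phi (sum_set P P') (sum_set Q Q').

Let A : {fset mlo 0 2} := [fset tau in Char n 0 2 | `[< wins_I b (disj (B tau)) >]]%fset.

Lemma wins_I_sum : wins_I a (disj A) -> wins_I (oadd a b) phi.
Proof.
move=> [f fc fW]; apply: won_I_sum; exists f => // Q.
have /holds_disj[tau] := fW Q; rewrite !inE /= => /andP[tC /asboolP[h hc hW]] st.
by exists h => // Q'; apply/(BP _ _ tC st).
Qed.

(** Determinacy of a lets Player II avoid the types in [A]. After any other type tau Player I does
    not win the goal [B tau] on b, so by determinacy of b Player II wins there. *)
Lemma wins_II_sum : ~ wins_I a (disj A) -> wins_II (oadd a b) phi.
Proof.
have [//|[f fc fW] _] := da (disj A); apply: won_II_sum; exists f => // P; apply.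
have [tau tC st] := Char_holds n P (f P).
have [hI|[h hc hW]] := db (disj (B tau)).
  case: (fW P); apply/holds_disj; exists tau => //.
  by rewrite !inE /= tC; apply/asboolP.
by exists h => // P' /(BP _ _ tC st); apply: hW.
Qed.

End SumGame.

Lemma determinate_sum (a b : wellorder) : inhabited a -> inhabited b ->
  determinate a -> determinate b -> determinate (oadd a b).
Proof.
move=> a0 b0 da db phi; set n := qd phi.
(* It is enough to ask for one pair of plays of types tau and sigma: by composition all such pairs
   give sums of the same type. *)
pose B tau : {fset mlo 0 2} := [fset sigma in Char n 0 2 |
  `[< exists P Q P' Q', [/\ @holds a tau P Q, @holds b sigma P' Q' &
      @holds (oadd a b) phi (sum_set P P') (sum_set Q Q')] >]]%fset.
have BP tau (P Q : set a) (P' Q' : set b) : tau \in Char n 0 2 -> holds tau P Q ->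
    holds (disj (B tau)) P' Q' <-> holds phi (sum_set P P') (sum_set Q Q').
  move=> tC st; split=> [/holds_disj[sigma]|sphi].
    rewrite !inE /= => /andP[sC /asboolP[P0 [Q0 [P0' [Q0' [st0 ss0 sphi]]]]]] ss.
    (* The sample sum has some type rho, the given sum has it as well, and [phi] has depth n, so it
       transfers. *)
    have [rho rC sr] := Char_holds n (sum_set P0 P0') (sum_set Q0 Q0').
    have sr' := (sum_typeP a0 b0 tC sC rC st ss).1
      ((sum_typeP a0 b0 tC sC rC st0 ss0).2 sr).
    exact/(Char_agree rC sr sr').
  have [sigma sC ss] := Char_holds n P' Q'.
  apply/holds_disj; exists sigma => //; rewrite !inE /= sC; apply/asboolP.
  by exists P, Q, P', Q'.
set A := wins_I a (disj [fset tau in Char n 0 2 | `[< wins_I b (disj (B tau)) >]]%fset).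
have [h|h] := EM A; [left; exact: wins_I_sum h | right; exact: wins_II_sum h].
Qed.

Section GameTypeSum.
Variables (a b : wellorder) (n : nat).
Hypotheses (a0 : inhabited a) (b0 : inhabited b) (da : determinate a) (db : determinate b).

(** Both conditions on the right are memberships in given game types. If the set of these tau could
    not be forced on a, Player II would win on a + b, which [won_I_II] excludes. *)
Lemma game_type_sum (G : {fset mlo 0 2}) : {subset G <= Char n 0 2} ->
  wins_I (oadd a b) (disj G) <->
  game_type n a [fset tau in Char n 0 2 |
    `[< game_type n b [fset sigma in Char n 0 2 |
          has (fun rho => sum_type (code rho) (code tau) (code sigma)) G] >]]%fset.
Proof.
move=> GC; set B := fun tau : mlo 0 2 => [fset sigma in Char n 0 2 |
  has (fun rho => sum_type (code rho) (code tau) (code sigma)) G]%fset.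
have BP tau (P Q : set a) (P' Q' : set b) : tau \in Char n 0 2 -> holds tau P Q ->
    holds (disj (B tau)) P' Q' <-> holds (disj G) (sum_set P P') (sum_set Q Q').
  move=> tC st; split=> [/holds_disj[sigma]|/holds_disj[rho rG sr]].
    rewrite !inE /= => /andP[sC /hasP[rho rG rts]] ss.
    by apply/holds_disj; exists rho => //; apply/(sum_typeP a0 b0 tC sC (GC _ rG) st ss).
  have [sigma sC ss] := Char_holds n P' Q'.
  apply/holds_disj; exists sigma => //; rewrite !inE /= sC; apply/hasP; exists rho => //.
  exact/(sum_typeP a0 b0 tC sC (GC _ rG) st ss).
have BE tau : game_type n b (B tau) <-> wins_I b (disj (B tau)).
  by split=> [[]|h] //; split=> // t; rewrite !inE => /andP[].
have -> : [fset tau in Char n 0 2 | `[< game_type n b (B tau) >]]%fset =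
    [fset tau in Char n 0 2 | `[< wins_I b (disj (B tau)) >]]%fset.
  by apply/fsetP => tau; rewrite !inE /=; congr (_ && _); apply/asboolP/asboolP => /BE.
set A := [fset tau in _ | _]%fset; split=> [hI|[_ hI]]; last exact: wins_I_sum hI.
split; first by move=> t; rewrite !inE => /andP[].
apply: contrapT => hA; exact: won_I_II hI (wins_II_sum da db BP hA).
Qed.

End GameTypeSum.

(** * The algorithm *)

(** Goal sets come as arbitrary enumerations and are compared up to order and repetition. *)
Definition same_set (s t : seq nat) :=
  all (fun c => c \in t) s && all (fun c => c \in s) t.

(** The list form of the goal left on b after a play of type [tau] on a. *)
Definition right_types (xs : seq (seq nat)) (G : seq nat) tau :=
  [seq sigma <- flatten xs | has (fun rho => sum_type rho tau sigma) G].

Definition left_types (xs ys : seq (seq nat)) (G : seq nat) :=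
  [seq tau <- flatten xs | has (same_set (right_types xs G tau)) ys].

(* flatten xs lists all n-types, as xs stands for the game type of a. *)
Definition sum_game_type (xs ys : seq (seq nat)) :=
  [seq G <- sublists (flatten xs) | has (same_set (left_types xs ys G)) xs].

Lemma comp_sum_game_type :
  computable (fun p : seq (seq nat) * seq (seq nat) => sum_game_type p.1 p.2).
Proof.
rewrite /sum_game_type /left_types /right_types /same_set /sum_type; comp.
  by apply: comp_sublists; comp.
(* [sum_type] passes rho to [sum_sat] twice, as fuel and as formula; [q] names this argument so that
   composition applies. *)
all: pose q T (r s t : T -> nat) x := (r x, (r x, s x, t x, (0, Nil nat))).
all: match goal with |- computable (fun x => sum_sat (@?r x) (_, @?s x, @?t x, _)) =>
  apply: (comp_comp (g := q _ r s t) comp_sum_sat); rewrite /q; comp end.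
Qed.

Lemma computable_recfn3 (A B C : Type) {eA : enc A} {eB : enc B} {eC : enc C}
    (F : A * B -> C) : computable F -> exists f : recfn 3, forall n a b,
  eval f [tuple n; encode a; encode b] (encode (F (a, b))).
Proof.
move=> [g cg gP].
have [f fP] : cmp (fun v : 3.-tuple nat => g (to_nat (tnth v (inord 1), tnth v (inord 2)))).
  by apply: cmp_ap1 cg (cmp_ap2 fun2_pair _ _); apply: cmp_proj.
have {}fP x y z : eval f [tuple x; y; z] (g (to_nat (y, z))).
  by have := fP [tuple x; y; z]; rewrite !(tnth_nth 0) !inordK.
by exists f => n a b; rewrite -(gP (a, b)).
Qed.

Lemma same_set_code (g h : seq (mlo 0 2)) :
  same_set (map (@code 0 2) g) (map (@code 0 2) h) <->
  [fset phi in g]%fset = [fset phi in h]%fset.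
Proof.
have sub (s t : seq (mlo 0 2)) :
    all (fun c => c \in map (@code 0 2) t) (map (@code 0 2) s) <-> {subset s <= t}.
  rewrite all_map; split=> [/allP st phi /st|st]; first by rewrite /= mem_map //; apply: code_inj.
  by apply/allP => phi /st /=; apply: map_f.
split=> [/andP[/sub gh /sub hg]|gh].
  by apply/fsetP => phi; rewrite !inE; apply/idP/idP => [/gh|/hg].
by apply/andP; split; apply/sub => phi ph; move/fsetP: gh => /(_ phi); rewrite !inE ph.
Qed.

Section Correctness.
Variables (a b : wellorder) (n : nat).
Hypotheses (a0 : inhabited a) (b0 : inhabited b) (da : determinate a) (db : determinate b).

Lemma has_same_set g (s : seq (seq (mlo 0 2))) (u : seq (mlo 0 2)) :
  game_type n g = [set` [seq [fset phi in h]%fset | h <- s]] ->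
  has (same_set (map (@code 0 2) u)) (map (map (@code 0 2)) s) <->
  game_type n g [fset phi in u]%fset.
Proof.
move=> ->; rewrite has_map; split=> [/hasP[h hs /same_set_code uh]|/mapP[h hs uh]].
  by rewrite uh /=; apply: map_f.
by apply/hasP; exists h => //; apply/same_set_code.
Qed.

Variables sx sy : seq (seq (mlo 0 2)).
Hypothesis xE : game_type n a = [set` [seq [fset phi in h]%fset | h <- sx]].
Hypothesis yE : game_type n b = [set` [seq [fset phi in h]%fset | h <- sy]].
Let xs := map (map (@code 0 2)) sx.
Let ys := map (map (@code 0 2)) sy.

(** Members of a game type consist of types, and the set of all types is one of the members. *)
Lemma mem_flatten_game_type : flatten sx =i Char n 0 2.
Proof.
move=> phi; apply/flattenP/idP => [[h hs ph]|pC].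
  have [hC _] : game_type n a [fset phi in h]%fset by rewrite xE; apply: map_f.
  by apply: hC; rewrite inE.
have : game_type n a [fset phi in Char n 0 2]%fset.
  split=> [t|]; first by rewrite inE.
  (* Any strategy would do, as every play satisfies some type. *)
  exists (fun=> set0) => // Q; apply/holds_disj.
  by have [t tC st] := Char_holds n (set0 : set a) Q; exists t => //; rewrite inE.
rewrite xE => /mapP[h hs hE]; exists h => //.
by move/fsetP: hE => /(_ phi); rewrite !inE pC.
Qed.

(** Two uses of [has_same_set], one for each summand, turn the list searches into the criterion of
    [game_type_sum]. *)
Lemma left_typesP (G : seq (mlo 0 2)) : {subset G <= Char n 0 2} ->
  has (same_set (left_types xs ys (map (@code 0 2) G))) xs <->
  wins_I (oadd a b) (disj [fset phi in G]%fset).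
Proof.
move=> GC; have GC' : {subset [fset phi in G]%fset <= Char n 0 2}.
  by move=> t; rewrite inE => /GC.
apply: (iff_trans _ (iff_sym (game_type_sum a0 b0 da db GC'))).
rewrite /left_types {1}/xs -map_flatten filter_map; apply: (iff_trans (has_same_set _ xE)).
set A := [fset phi in _]%fset; set A' := [fset tau in _ | _]%fset.
suff -> : A = A' by [].
apply/fsetP => tau; rewrite !inE mem_filter mem_flatten_game_type andbC; congr (_ && _).
apply/idP/asboolP; rewrite /= /right_types -map_flatten filter_map (has_same_set _ yE).
all: set D := (X in game_type n b X -> _); set D' := (X in _ -> game_type n b X).
all: suff -> : D = D' by [].
all: apply/fsetP => sigma; rewrite !inE mem_filter mem_flatten_game_type andbC; congr (_ && _).
all: rewrite /= has_map; apply/hasP/hasP => -[rho rG rts]; exists rho => //;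
  by move: rG; rewrite inE.
Qed.

Lemma sum_game_typeP : is_code (encode (sum_game_type xs ys)) (game_type n (oadd a b)).
Proof.
pose p G := has (same_set (left_types xs ys (map (@code 0 2) G))) xs.
exists (filter p (sublists (flatten sx))); last first.
  rewrite /sum_game_type {1}/xs -map_flatten map_sublists filter_map /=.
  by congr code_seq; rewrite -map_comp; apply: eq_map => G /=; rewrite map_id.
have subC G : G \in sublists (flatten sx) -> {subset G <= Char n 0 2}.
  by move=> /mem_sublists GC t /GC; rewrite mem_flatten_game_type.
apply/seteqP; split=> [G [GC hI]|G /mapP[h + ->]]; last first.
  rewrite mem_filter => /andP[ph hs]; have hC := subC _ hs.
  by split; [move=> t; rewrite inE => /hC | apply/left_typesP].
(* The list of all types filtered by membership in G is one of the enumerated lists and represents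
   G. *)
pose h := [seq t <- flatten sx | t \in G].
have hE : [fset phi in h]%fset = G.
  apply/fsetP => t; rewrite !inE mem_filter mem_flatten_game_type.
  by apply/andP/idP => [[]|tG] //; split=> //; apply: GC.
apply/mapP; exists h; last by rewrite hE.
rewrite mem_filter filter_sublists andbT; apply/left_typesP; last by rewrite hE.
exact/subC/filter_sublists.
Qed.

End Correctness.

Theorem theorem4p2 :
  (forall a b : wellorder, inhabited a -> inhabited b ->
     determinate a -> determinate b -> determinate (oadd a b)) /\
  (exists f : recfn 3, forall (n : nat) (a b : wellorder),
     inhabited a -> inhabited b -> determinate a -> determinate b ->
     forall x y : nat, is_code x (game_type n a) -> is_code y (game_type n b) ->
     exists z : nat, eval f [tuple n; x; y] z /\ is_code z (game_type n (oadd a b))).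
Proof.
split; first exact: determinate_sum.
have [f fP] := computable_recfn3 comp_sum_game_type; exists f => n a b a0 b0 da db x y.
have codeE (s : seq (seq (mlo 0 2))) :
    code_seq [seq code_seq [seq code phi | phi <- g] | g <- s] =
    encode (map (map (@code 0 2)) s).
  by congr code_seq; rewrite -map_comp; apply: eq_map => g /=; rewrite map_id.
move=> [sx xE ->] [sy yE ->]; rewrite !codeE; eexists; split; first exact: fP.
exact: sum_game_typeP.
Qed.
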